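(* Let $G$ be a finite group. If $T(G)>\frac14|G|$, then either $G$ is solvable of Fitting height at most $4$, or $G\cong \mathrm{A}_5\times Z$ for some abelian group $Z$.
   Context: For a finite group $G$, $\mathrm{Irr}(G)$ denotes the set of irreducible complex characters of $G$, and $T(G)=\sum_{\chi\in\mathrm{Irr}(G)}\chi(1)$ is the sum of their degrees. $\mathrm{A}_5$ is the alternating group of degree $5$. The Fitting subgroup $\mathbf{F}(G)$ is the largest nilpotent normal subgroup of $G$. The Fitting height of a finite solvable group $G$ is the least $n\ge 0$ such that $F_n=G$, where $F_0=1$ and $F_{i+1}/F_i=\mathbf{F}(G/F_i)$. *)

(* Defs.v *)
From mathcomp Require Import all_boot all_order all_algebra all_fingroup.
From mathcomp Require Import all_solvable all_field all_character.

Set Implicit Arguments.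
Unset Strict Implicit.
Unset Printing Implicit Defensive.

Import GroupScope.

(* The type algC of algebraic complex numbers, in which MathComp characters
   take their values, contains all values of complex characters of finite
   groups. *)
Definition char_degree_sum (gT : finGroupType) (G : {group gT}) : algC :=
  (\sum_(i : Iirr G) 'chi[G]_i 1%g)%R.

Definition fitting_series (n : nat) (gT : finGroupType) (A : {set gT}) :=
  iter n (fun B => coset B @*^-1 'F(A / B)) 1.

(* The search is bounded by #|A|, which is also the value returned when the
   series never reaches A; by fitting_height_le the bound is harmless for a
   solvable group. *)
Definition fitting_height (gT : finGroupType) (A : {set gT}) : nat :=
  index A (mkseq (fun n => fitting_series n A) #|A|).

Section FittingSeries.

Variable n : nat.

Lemma fitting_series_pmap :
  exists hF : GFunctor.pmap, @fitting_series n = hF.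
Proof.
elim: n => [|n' [hF defF]]; first by exists trivGfun_pgFun.
by exists [pgFun of @Fitting %% hF]; rewrite /= -defF.
Qed.

Lemma fitting_series_group_set gT (G : {group gT}) :
  group_set (fitting_series n G).
Proof. by have [hF ->] := fitting_series_pmap; apply: groupP. Qed.

Canonical fitting_series_group gT (G : {group gT}) :=
  Group (fitting_series_group_set G).

Lemma fitting_series_normal gT (G : {group gT}) : fitting_series n G <| G.
Proof. by have [hF ->] := fitting_series_pmap; apply: gFnormal. Qed.

End FittingSeries.

Section FittingHeight.

Variables (gT : finGroupType) (G : {group gT}).
Implicit Type n : nat.

Lemma fitting_series_quo n :
  fitting_series n.+1 G / fitting_series n G = 'F(G / fitting_series n G).
Proof. exact: cosetpreK. Qed.

Lemma fitting_seriesS n : fitting_series n G \subset fitting_series n.+1 G.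
Proof.
exact: (sub_cosetpre (Fitting_group (G / fitting_series n G))).
Qed.

Lemma fitting_series_stop m n :
  m <= n -> fitting_series m G = G -> fitting_series n G = G.
Proof.
move=> /subnK <-; elim: (n - m)%N => // k IHk /IHk eqG.
apply/eqP; rewrite addSn eqEsubset normal_sub ?fitting_series_normal //=.
by rewrite -{1}eqG fitting_seriesS.
Qed.

Lemma fitting_series_proper n :
  solvable G -> fitting_series n G != G ->
  fitting_series n G \proper fitting_series n.+1 G.
Proof.
move=> solG; apply: contraR; rewrite properE fitting_seriesS negbK => sF.
have nF := fitting_series_normal n G.
have : 'F(G / fitting_series n G) == 1.
  rewrite -fitting_series_quo -subG1 quotient_sub1 //.
  by apply: subset_trans (normal_norm nF); rewrite normal_sub ?fitting_series_normal.
rewrite trivg_Fitting ?quotient_sol // -subG1 quotient_sub1 ?normal_norm //.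
by rewrite eqEsubset normal_sub.
Qed.

Lemma fitting_series_card n :
  solvable G -> fitting_series n G = G \/ n < #|fitting_series n G|.
Proof.
move=> solG; elim: n => [|n [eqG | ltn]]; first by right; rewrite cards1.
  by left; apply: fitting_series_stop eqG.
have [eqG | neG] := eqVneq (fitting_series n G) G.
  by left; apply: fitting_series_stop eqG.
right; apply: leq_ltn_trans ltn _.
exact/proper_card/fitting_series_proper.
Qed.

Lemma fitting_height_le n :
  solvable G -> (fitting_height G <= n) = (fitting_series n G == G).
Proof.
move=> solG; pose s := mkseq (fun n => fitting_series n G) #|G|.
have s_size : size s = #|G| by rewrite size_mkseq.
have sG : (G : {set gT}) \in s.
  have lt1 : #|G|.-1 < #|G| by rewrite prednK ?cardG_gt0.
  apply/(nthP 1); exists #|G|.-1; first by rewrite s_size.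
  rewrite nth_mkseq //; case: (fitting_series_card #|G|.-1 solG) => //.
  rewrite prednK ?cardG_gt0 // => leG; apply/eqP.
  by rewrite eqEcard normal_sub ?fitting_series_normal.
have hG : fitting_series (fitting_height G) G = G.
  have := nth_index 1 sG; rewrite nth_mkseq //.
  by move: sG; rewrite -index_mem s_size.
apply/idP/eqP => [le_h_n | eqG]; first exact: fitting_series_stop hG.
rewrite leqNgt; apply/negP=> lt_n_h.
have lt_n_G : n < #|G|.
  by apply: leq_trans lt_n_h _; rewrite -s_size index_size.
by have := before_find 1 lt_n_h; rewrite nth_mkseq //= eqG eqxx.
Qed.

End FittingHeight.

(* Main.v *)
(** Write k(G) for the number of conjugacy classes.  By AM-GM,
    8 d <= d^2 + 16 for each degree d, so T(G) > |G|/4 forces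
    16 k(G) > |G|: more than 1/16 of all pairs of elements commute.

    If G is solvable of Fitting height at least 5, kill O_{q'}(G) for a prime q
    that keeps the height, so that the Fitting subgroup F becomes a q-group
    containing its centraliser; then an element outside F centralises at most
    1/q of F, and the proportion of commuting pairs drops by about a factor q
    from G/F to G.  Consecutive primes differ, and four such steps bring the
    proportion below 1/16.

    If G is not solvable, let P be a nontrivial perfect normal subgroup; the
    inequality passes to P.  Counting commuting pairs shows that a maximal
    normal subgroup M of P is central.  Averaging over the linear characters of
    M gives a block of Irr(P) of large degree sum, which contains some chi of
    degree 3 unless P has a character of degree 2; decomposing chi chi^* and
    chi^2, with their values at an involution of P/M if there is one, produces
    a real character of degree 3 of P/M.  Its
    representation turns the elements of P/M into rotations, and Klein's count
    of the poles gives |P/M| = 60.  Each block over a nontrivial character of M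
    has at most five characters, all of even degree and with squares summing to
    60, hence degree sum at most 14 < 60/4, while the principal block has 16;
    this forces M = 1.  Finally G acts on the five Sylow 2-subgroups of P.  Odd
    permutations would fuse two irreducible characters of P and make T(G) too
    small; otherwise G = P x C_G(P), and C_G(P) is abelian because k(G) is
    large. *)

Require Import Defs.
From mathcomp Require Import all_boot all_order all_algebra all_fingroup.
From mathcomp Require Import all_solvable all_field all_character.
From mathcomp Require Import zify ring.

Set Implicit Arguments.
Unset Strict Implicit.
Unset Printing Implicit Defensive.

Import GroupScope.
Local Open Scope nat_scope.

(** * Commuting pairs *)

Definition commuting_pairs (gT : finGroupType) (G : {set gT}) : nat :=
  \sum_(x in G) #|'C_G[x]|.

(** The orbit-counting formula for G acting on itself by conjugation, where the fixed points of x
    are its centraliser. *)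
Lemma commuting_pairsE (gT : finGroupType) (G : {group gT}) :
  commuting_pairs G = (#|classes G| * #|G|)%N.
Proof.
have actsG : [acts G, on G | 'J] by apply/actsP=> x Gx y; apply: groupJr.
have := Frobenius_Cauchy actsG.
have -> : orbit 'J G @: G = classes G by apply: eq_imset => x; rewrite orbitJ.
move=> <-; apply: eq_bigr => x Gx; apply: eq_card => y; rewrite !in_setI.
congr (_ && _); apply/cent1P/afix1P => /= [/commgP/conjg_fixP//|].
by move/conjg_fixP/commgP.
Qed.

Lemma commuting_pairs_gt0 (gT : finGroupType) (G : {group gT}) : 0 < commuting_pairs G.
Proof. by rewrite commuting_pairsE muln_gt0 cardG_gt0 (classes_gt0 G). Qed.

Lemma commuting_pairs_le (gT : finGroupType) (G : {group gT}) : commuting_pairs G <= #|G| ^ 2.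
Proof.
rewrite -mulnn -sum_nat_const; apply: leq_sum => x _.
by rewrite subset_leq_card ?subsetIl.
Qed.

Lemma card_classes_le (gT : finGroupType) (G : {group gT}) : #|classes G| <= #|G|.
Proof.
by have := commuting_pairs_le G; rewrite commuting_pairsE -mulnn leq_pmul2r.
Qed.

Lemma sum_cent1_exchange (gT : finGroupType) (A B : {set gT}) :
  \sum_(x in A) #|'C_B[x]| = \sum_(y in B) #|'C_A[y]|.
Proof.
under eq_bigr => x _ do rewrite -sum1_card; under [RHS]eq_bigr => x _ do rewrite -sum1_card.
rewrite !pair_big_dep /= (reindex_onto (fun p => (p.2, p.1)) (fun p => (p.2, p.1))) /=; last by case.
apply: eq_bigl => -[x y] /=; rewrite eqxx andbT !in_setI.
by rewrite cent1C; case: (y \in A); case: (x \in B); rewrite ?andbF.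
Qed.

Section Quotient.

Variables (gT : finGroupType) (G N : {group gT}).
Hypothesis nsNG : N <| G.

Lemma card_coset_fiber x : x \in G -> [set z in G | coset N z == coset N x] = N :* x.
Proof.
have [sNG nNG] := andP nsNG; move=> Gx; apply/setP=> z; rewrite inE.
have Nx := subsetP nNG x Gx; apply/andP/idP => [[Gz /eqP eq_zx] | Nxz].
  by apply/rcoset_kercosetP; rewrite ?(subsetP nNG).
have Gz : z \in G by case/rcosetP: Nxz => n Nn ->; rewrite groupM // (subsetP sNG).
by split=> //; apply/eqP/rcoset_kercosetP; rewrite ?(subsetP nNG).
Qed.

Lemma sum_fibers (F : gT -> nat) :
  \sum_(x in G) F x = \sum_(y in G / N) \sum_(x in G | coset N x == y) F x.
Proof.
rewrite (partition_big (coset N) (fun y => y \in G / N)) //=.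
by move=> x Gx; apply: mem_quotient.
Qed.

Lemma sum_cosets (F : coset_of N -> nat) :
  \sum_(x in G) F (coset N x) = (#|N| * \sum_(y in G / N) F y)%N.
Proof.
rewrite sum_fibers big_distrr /=; apply: eq_bigr => y /morphimP[x Nx Gx ->].
rewrite (eq_bigr (fun=> F (coset N x))); last by move=> z /andP[_ /eqP->].
by rewrite sum_nat_const -(card_rcoset N x) -card_coset_fiber // cardsE.
Qed.

(** The quotient map sends C_G(x) into the centraliser of its image, with kernel C_N(x). *)
Lemma card_cent1_quo x : x \in G ->
  #|'C_G[x]| <= #|'C_(G / N)[coset N x]| * #|'C_N[x]|.
Proof.
have [sNG nNG] := andP nsNG; move=> Gx.
rewrite -(LagrangeI 'C_G[x] N) mulnC -card_quotient; last first.
  by rewrite (subset_trans _ nNG) ?subsetIl.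
rewrite setIAC (setIidPr sNG) leq_mul2r subset_leq_card ?orbT //.
by apply: quotient_subcent1.
Qed.

(** Let d be the proportion of commuting pairs. For m > 0 this says d(G) <= d(G/N)/m + (1 -
    1/m)/|G/N|^2. Pairs with an entry outside N lose a factor m: if the first entry x is outside,
    |C_G(x)| splits as in [card_cent1_quo]; if only the second is, the hypothesis is used directly.
    The last term is the price of the pairs inside N, bounded trivially by |N|^2. *)
Lemma commuting_pairs_quo m :
    (forall x, x \in G -> x \notin N -> m * #|'C_N[x]| <= #|N|) ->
  m * commuting_pairs G + #|N| ^ 2 <= #|N| ^ 2 * commuting_pairs (G / N) + m * #|N| ^ 2.
Proof.
have [sNG nNG] := andP nsNG; move=> mC; rewrite {1}/commuting_pairs.
have -> : \sum_(x in G) #|'C_G[x]| =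
  (\sum_(x in N) #|'C_G[x]| + \sum_(x in G :\: N) #|'C_G[x]|)%N.
  by rewrite (big_setID N) /= (setIidPr sNG).
have -> : \sum_(x in N) #|'C_G[x]| =
  (commuting_pairs N + \sum_(x in G :\: N) #|'C_N[x]|)%N.
  by rewrite sum_cent1_exchange (big_setID N) /= (setIidPr sNG).
have le1 : m * commuting_pairs N <= m * #|N| ^ 2.
  rewrite leq_mul2l; apply/orP; right; rewrite -mulnn -sum_nat_const.
  by apply: leq_sum => x _; rewrite subset_leq_card ?subsetIl.
have le2 : m * \sum_(x in G :\: N) #|'C_N[x]| + #|N| ^ 2 <= #|N| * #|G|.
  rewrite -(cardsID N G) (setIidPr sNG) mulnDr mulnn addnC leq_add2l big_distrr /=.
  by rewrite mulnC -sum_nat_const leq_sum // => x /setDP[Gx /mC->].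
have le3 : m * \sum_(x in G :\: N) #|'C_G[x]| + #|N| * #|G| <=
    #|N| ^ 2 * commuting_pairs (G / N).
  rewrite /commuting_pairs -mulnn -mulnA -sum_cosets.
  rewrite [X in _ <= _ * X](big_setID N) /= (setIidPr sNG) mulnDr addnC.
  apply: leq_add; last first.
    rewrite !big_distrr /=; apply: leq_sum => x /setDP[Gx N'x].
    rewrite mulnC (leq_trans (leq_mul (card_cent1_quo Gx) (leqnn m))) //.
    by rewrite -mulnA mulnC leq_mul2r mulnC mC ?orbT.
  rewrite leq_mul2l; apply/orP; right.
  rewrite (eq_bigr (fun=> #|G / N|)) => [|x Nx].
    by rewrite sum_nat_const card_quotient // Lagrange.
  by rewrite coset_id // cent11T setIT.
rewrite !mulnDr; lia.
Qed.

(** For n in N, the elements of a coset Ng that commute with n are either absent or form a coset of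
    C_N(n). Hence |C_N(x)| summed over x in Ng is at most the number of commuting pairs of N. *)
Lemma commuting_pairs_mul :
  commuting_pairs G <= commuting_pairs (G / N) * commuting_pairs N.
Proof.
have [sNG nNG] := andP nsNG; rewrite {1}/commuting_pairs sum_fibers.
rewrite {1}/commuting_pairs big_distrl /=; apply: leq_sum => y /morphimP[g Ng Gg ->].
have := card_coset_fiber Gg; set B := [set _ in _ | _] => defB.
apply: leq_trans (_ : #|'C_(G / N)[coset N g]| * \sum_(x in B) #|'C_N[x]| <= _).
  rewrite big_distrr /= (eq_bigl (fun x => x \in B)) => [|x]; last by rewrite inE.
  by apply: leq_sum => x /[!inE] /andP[Gx /eqP <-]; apply: card_cent1_quo.
rewrite leq_mul2l; apply/orP; right; rewrite sum_cent1_exchange.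
apply: leq_sum => n Nn; rewrite defB.
have [->|[h /setIP[Ngh cnh]]] := set_0Vmem ((N :* g) :&: 'C[n]); first by rewrite cards0.
rewrite -(card_rcoset _ h^-1%g) subset_leq_card //; apply/subsetP=> _ /rcosetP[x /setIP[Ngx cnx] ->].
apply/setIP; split; last by rewrite groupM ?groupV.
by rewrite -mem_rcoset (rcoset_eqP Ngh).
Qed.

Lemma classes_quo_mul : #|classes G| <= #|classes (G / N)| * #|classes N|.
Proof.
have := commuting_pairs_mul; rewrite !(commuting_pairsE, commuting_pairsE (G / N)).
have [sNG nNG] := andP nsNG.
rewrite mulnACA -[(#|G / N| * _)%N]mulnC card_quotient // Lagrange // leq_pmul2r //.
Qed.

End Quotient.

(** * Solvable groups *)

(* For n >= #|G| the term 'L_n.+1 of the lower central series is the nilpotent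
   residual; a bound n uniform in the quotients keeps the iterates comparable. *)
Definition nil_residual (n k : nat) (gT : finGroupType) (G : {group gT}) : {group gT} :=
  iter k (fun H : {group gT} => 'L_n.+1(H)%G) G.

Section NilResidual.

Variable n : nat.

Lemma nil_residual_char k (gT : finGroupType) (G : {group gT}) :
  nil_residual n k G \char G.
Proof.
by elim: k => [|k IHk] /=; [apply: char_refl | apply: char_trans IHk; apply: lcn_char].
Qed.

Lemma nil_residual_quo k (gT : finGroupType) (G N : {group gT}) : G \subset 'N(N) ->
  nil_residual n k (G / N) = nil_residual n k G / N :> {set _}.
Proof.
move=> nNG; elim: k => //= k ->; rewrite /quotient morphim_lcn //.
by apply: subset_trans nNG; apply: char_sub (nil_residual_char _ _).
Qed.

Lemma lcn_nil1 (gT : finGroupType) (G : {group gT}) :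
  #|G| <= n -> nilpotent G -> 'L_n.+1(G) = 1%g.
Proof.
move=> leGn nilG; apply/(lcn_nil_classP n nilG).
by rewrite (leq_trans (ltnW _) leGn) // -nilpotent_class.
Qed.

(** By induction on i, the (k-i)-th residual lies in the i-th term F_i of the Fitting series: modulo
    F_i, the residual one step earlier becomes nilpotent and normal, so it falls into the Fitting
    subgroup of G/F_i. *)
Lemma fitting_series_full k (gT : finGroupType) (G : {group gT}) :
  nil_residual n k G = 1%G -> fitting_series k G = G.
Proof.
move=> res1; apply/eqP; rewrite eqEsubset normal_sub ?fitting_series_normal //=.
suffices: forall i, i <= k -> nil_residual n (k - i) G \subset fitting_series i G.
  by move/(_ k (leqnn k)); rewrite subnn.
elim=> [|i IHi] lt_ik; first by rewrite subn0 res1.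
have{IHi} := IHi (ltnW lt_ik); rewrite -(subSS i k) subSn //.
set X := nil_residual n (k - i.+1) G => /= sLF.
have nsF := fitting_series_normal i G; have [sFG nFG] := andP nsF.
have sXG : X \subset G := char_sub (nil_residual_char _ _).
have nFX := subset_trans sXG nFG.
suffices : X / fitting_series i G \subset 'F(G / fitting_series i G).
  by rewrite -sub_quotient_pre.
apply: Fitting_max.
  by rewrite quotient_normal // char_normal ?nil_residual_char.
by apply/lcnP; exists n; rewrite /quotient -morphim_lcn //; apply/trivgP; rewrite quotient_sub1 // (subset_trans (lcn_sub _ _)).
Qed.

End NilResidual.

(** Climb the derived series of C = C_G(F(G)): if the derived subgroup of C^(m) lies in F(G), it is
    centralised by C, so C^(m) has class at most 2 and, being normal, lies in F(G). *)
Lemma cent_Fitting_sub (gT : finGroupType) (G : {group gT}) :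
  solvable G -> 'C_G('F(G)) \subset 'F(G).
Proof.
move=> solG; set C := 'C_G('F(G)).
have nsCG : C <| G by rewrite norm_normalI ?norms_cent ?gFnorm.
have /derivedP[m] : solvable C by apply: solvableS (normal_sub nsCG) solG.
move=> Cm1; have {Cm1}: C^`(m) \subset 'F(G) by rewrite Cm1 sub1G.
elim: m => [|m IHm]; first by rewrite derg0.
rewrite dergSn => sDF; apply: IHm; apply: Fitting_max.
  by rewrite (char_normal_trans (der_char m _)).
apply/lcnP; exists 2; rewrite lcnSn; apply/commG1P.
rewrite -[lower_central_at _ _]/(C^`(m.+1)).
rewrite (subset_trans sDF) // centsC (subset_trans (der_sub m _)) //.
exact: subsetIr.
Qed.

Section FittingStep.

Variables (n p k : nat) (gT : finGroupType) (G : {group gT}).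
Hypotheses (leGn : #|G| <= n) (solG : solvable G) (Op1 : 'O_p(G) = 1%g).
Hypothesis resG : nil_residual n k.+1 G != 1%G.

(** Otherwise the residual would be a p-group, hence contained in O_p(G) = 1. *)
Lemma nil_residual_prime :
  exists q, [/\ prime q, q != p & ~~ (nil_residual n k.+1 G \subset 'O_q^'(G))].
Proof.
set R := nil_residual n k.+1 G.
have nsRG : R <| G by apply: char_normal; apply: nil_residual_char.
have [/allP sRO|/allPn[q piq]] :=
  boolP (all (fun q => (q == p) || (R \subset 'O_q^'(G))) (primes #|G|)); last first.
  by rewrite negb_or => /andP[neq sRO]; exists q; rewrite neq; move: piq; rewrite mem_primes; case/andP.
case/negP: resG; rewrite -[_ == _]val_eqE -/R -[_ == _]subG1 -Op1; apply: pcore_max => //.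
apply/pgroupP => q pr_q q_R; have piq : q \in primes #|G|.
  by rewrite mem_primes pr_q cardG_gt0 (dvdn_trans q_R) ?cardSg ?normal_sub.
have /orP[//|sROq] := sRO q piq.
have := pgroupP (pgroupS sROq (pcore_pgroup _ _)) q pr_q q_R.
by rewrite !inE eqxx.
Qed.

Lemma Fitting_step : exists q, [/\ prime q, q != p &
  exists (rT : finGroupType) (H : {group rT}),
  [/\ solvable H, #|H| * q <= #|G|, 'O_q(H) = 1%g, nil_residual n k H != 1%G &
   (q * commuting_pairs G) * #|H| ^ 2 <= #|G| ^ 2 * (commuting_pairs H + (q - 1))]].
Proof.
have [q [pr_q neqp sRO]] := nil_residual_prime; exists q; split=> //.
set K := 'O_q^'(G) in sRO; have nsKG : K <| G := pcore_normal _ _.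
have [sKG nKG] := andP nsKG.
pose G1 := (G / K)%G; have solG1 : solvable G1 := quotient_sol K solG.
have O1 : 'O_q^'(G1) = 1%g by apply: trivg_pcore_quotient.
have F1 : 'F(G1) = 'O_q(G1) := Fitting_eq_pcore O1.
have resG1 : nil_residual n k.+1 G1 != 1%G.
  apply: contraNneq sRO => res1; rewrite -quotient_sub1; last first.
    by rewrite (subset_trans _ nKG) // char_sub // nil_residual_char.
  by rewrite -(nil_residual_quo n k.+1 nKG) res1.
have leG1n : #|G1| <= n by rewrite (leq_trans _ leGn) // leq_quotient.
pose N := 'O_q(G1)%G; have nsN : N <| G1 := pcore_normal _ _.
have [sNG1 nNG1] := andP nsN.
have ntG1 : G1 :!=: 1%g.
  apply: contraNneq resG1 => G11; rewrite -val_eqE -subG1.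
  by apply: subset_trans (char_sub (nil_residual_char n k.+1 G1)) _; rewrite G11.
have ntN : N :!=: 1%g by rewrite /= -F1 trivg_Fitting.
have [_ qN [m cN]] := pgroup_pdiv (pcore_pgroup q G1) ntN.
have cG1 : #|G1| = (#|N| * #|G1 / N|)%N by rewrite card_quotient // Lagrange.
have cG : #|G| = (#|K| * #|G1|)%N by rewrite card_quotient // Lagrange.
exists _, (G1 / N)%G; split.
- exact: quotient_sol.
- rewrite cG cG1 mulnA mulnC leq_mul2r (leq_trans (dvdn_leq _ qN)) ?cardG_gt0 ?orbT //.
  by rewrite leq_pmull.
- exact: trivg_pcore_quotient.
(* If the k-th residual of H is trivial, that of G/K lies in the nilpotent group N, so the next one
   is trivial. *)
- apply: contraNneq resG1 => res1; rewrite -val_eqE /=.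
  have sRN : nil_residual n k G1 \subset N.
    rewrite -quotient_sub1 ?(subset_trans _ nNG1) ?char_sub ?nil_residual_char //.
    by rewrite -nil_residual_quo // res1.
  apply/eqP/lcn_nil1; last by apply: nilpotentS sRN (pgroup_nil (pcore_pgroup _ _)).
  by rewrite (leq_trans _ leG1n) ?subset_leq_card ?(subset_trans sRN).
have := commuting_pairs_quo nsN (m := q) _; rewrite -/G1 => /(_ _)/wrap[].
  move=> x G1x N'x; have sCN : 'C_N[x] \subset N := subsetIl _ _.
  have [q_i | i1] : q %| #|N : 'C_N[x]| \/ #|N : 'C_N[x]| = 1%N.
    have := dvdn_indexg N 'C_N[x]; rewrite cN => /dvdn_pfactor[] // [|i] _ ->; first by right.
    by left; rewrite expnS dvdn_mulr.
  - by rewrite -(Lagrange sCN) mulnC leq_mul2l dvdn_leq ?orbT // indexg_gt0.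
  - case/negP: N'x; have /eqP := i1; rewrite indexg_eq1 subsetI subxx /= => sNC.
    have := subsetP (cent_Fitting_sub solG1) x; rewrite F1; apply.
    by rewrite inE G1x -sub_cent1.
(* With m = 1: factoring out K does not lower the proportion of commuting pairs. *)
have le1 : commuting_pairs G <= #|K| ^ 2 * commuting_pairs G1.
  have := @commuting_pairs_quo _ G K nsKG 1; rewrite !mul1n leq_add2r; apply.
  by move=> x _ _; rewrite mul1n subset_leq_card ?subsetIl.
move=> le2; rewrite cG cG1 {cG cG1}; have q0 := prime_gt0 pr_q.
rewrite /=; move: le1 le2; move: (commuting_pairs G) (commuting_pairs G1) (commuting_pairs (G1 / N)).
move: #|K| #|N| #|(G1 / N)%g| => a b h c c1 cH le1 le2.
have le3 : q * c1 <= b ^ 2 * (cH + (q - 1)).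
  rewrite mulnDr mulnBr muln1 addnBA ?leq_pmulr // leq_subRL.
    by rewrite [leqLHS]addnC [b ^ 2 * q]mulnC.
  by rewrite (leq_trans (leq_pmulr _ q0)) ?leq_addl.
have -> : (a * (b * h)) ^ 2 * (cH + (q - 1)) = a ^ 2 * (b ^ 2 * (cH + (q - 1))) * h ^ 2.
  by rewrite !expnMn; ring.
rewrite leq_mul2r; apply/orP; right.
by rewrite (leq_trans _ (leq_mul (leqnn _) le3)) // mulnCA leq_mul2l le1 orbT.
Qed.

End FittingStep.

(* Only a lower bound r on the prime q is kept: a lower bound a / b of
   |H|^2 / commuting_pairs H, corrected by r - 1, yields r a / b for G. *)
Lemma Fitting_step_bound q r a b c c' h h' :
  0 < h' -> 0 < c' -> r <= q -> 0 < q ->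
  (q * c) * h' ^ 2 <= h ^ 2 * (c' + (q - 1)) -> a * (c' + (r - 1)) <= b * h' ^ 2 ->
  0 < r -> r * a * c <= b * h ^ 2.
Proof.
move=> h'0 c'0 le_rq q0 le1 le2 r0.
have le3 : r * (c' + (q - 1)) <= q * (c' + (r - 1)) by nia.
have h'20 : 0 < h' ^ 2 by rewrite expn_gt0 h'0.
rewrite -(leq_pmul2r h'20) -(leq_pmul2l q0).
move: (h ^ 2) (h' ^ 2) h'20 le1 le2 => x y y0 le1 le2.
have -> : q * (r * a * c * y) = (r * a) * (q * c * y) by ring.
have -> : q * (b * x * y) = (x * q) * (b * y) by ring.
apply: leq_trans (leq_mul (leqnn _) le1) _.
apply: leq_trans (leq_mul (leqnn _) le2).
have -> : r * a * (x * (c' + (q - 1))) = (a * x) * (r * (c' + (q - 1))) by ring.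
have -> : x * q * (a * (c' + (r - 1))) = (a * x) * (q * (c' + (r - 1))) by ring.
by rewrite leq_mul2l le3 orbT.
Qed.

Lemma nil_residual4_commuting (n : nat) (gT : finGroupType) (G : {group gT}) :
  #|G| <= n -> solvable G -> nil_residual n 4 G != 1%G ->
  16 * commuting_pairs G <= #|G| ^ 2.
Proof.
move=> leGn solG res4.
(* The first step has no prime to avoid; the non-prime 0 serves as a dummy. *)
have O01 : 'O_0(G) = 1%g.
  apply/trivgP/idPn=> ntO; have /pgroup_pdiv[] := pcore_pgroup 0 G; last by [].
  by rewrite -subG1.
have [q1 [pr1 _ [T1 [H1 [sol1 le1 O1 res3 ine1]]]]] := Fitting_step leGn solG O01 res4.
have leH1 : #|H1| <= n by rewrite (leq_trans _ leGn) // (leq_trans _ le1) // leq_pmulr ?prime_gt0.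
have [q2 [pr2 neq2 [T2 [H2 [sol2 le2 O2 res2 ine2]]]]] := Fitting_step leH1 sol1 O1 res3.
have leH2 : #|H2| <= n by rewrite (leq_trans _ leH1) // (leq_trans _ le2) // leq_pmulr ?prime_gt0.
have [q3 [pr3 neq3 [T3 [H3 [sol3 le3 O3 res1 ine3]]]]] := Fitting_step leH2 sol2 O2 res2.
have leH3 : #|H3| <= n by rewrite (leq_trans _ leH2) // (leq_trans _ le3) // leq_pmulr ?prime_gt0.
have [q4 [pr4 neq4 [T4 [H4 [sol4 le4 O4 res0 ine4]]]]] := Fitting_step leH3 sol3 O3 res1.
have gt1 : 1 < #|H4|.
  by rewrite cardG_gt1; apply: contraNneq res0 => H41; apply/eqP/group_inj.
(* A group of order 2 would be its own O_2, against O_2(H4) = 1. *)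
have gt2 : q4 = 2 -> 2 < #|H4|.
  move=> q42; rewrite ltn_neqAle gt1 andbT; apply/eqP=> H42.
  have O2H4 : 'O_2(H4) = H4 by apply: pcore_pgroup_id; rewrite /pgroup -H42 pnat_id.
  by move: gt1 O4; rewrite q42 O2H4 => gt1 H41; rewrite H41 cards1 in gt1.
have g1 := prime_gt1 pr1; have g2 := prime_gt1 pr2; have g3 := prime_gt1 pr3; have g4 := prime_gt1 pr4.
have := cardG_gt0 H1; have := cardG_gt0 H2; have := cardG_gt0 H3.
have := commuting_pairs_gt0 H1; have := commuting_pairs_gt0 H2.
have := commuting_pairs_gt0 H3; have := commuting_pairs_gt0 H4; have := commuting_pairs_le H4.
move: #|H4| #|H3| #|H2| #|H1| #|G| (commuting_pairs _) (commuting_pairs H3)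
  (commuting_pairs H2) (commuting_pairs H1) (commuting_pairs G)
  gt1 gt2 le1 le2 le3 le4 ine1 ine2 ine3 ine4.
move=> h4 h3 h2 h1 h0 c4 c3 c2 c1 c0 gt1 gt2 le1 le2 le3 le4 i1 i2 i3 i4.
move=> c4h c4_gt0 c3_gt0 c2_gt0 c1_gt0 h3_gt0 h2_gt0 h1_gt0.
have h4_gt0 : 0 < h4 by apply: ltnW.
have B4 r a b : r <= q4 -> 0 < r -> a * (c4 + (r - 1)) <= b * h4 ^ 2 -> r * a * c3 <= b * h3 ^ 2.
  by move=> ler r0 le; apply: Fitting_step_bound i4 le r0 => //; apply: ltnW.
have B3 r a b : r <= q3 -> 0 < r -> a * (c3 + (r - 1)) <= b * h3 ^ 2 -> r * a * c2 <= b * h2 ^ 2.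
  by move=> ler r0 le; apply: Fitting_step_bound i3 le r0 => //; apply: ltnW.
have B2 r a b : r <= q2 -> 0 < r -> a * (c2 + (r - 1)) <= b * h2 ^ 2 -> r * a * c1 <= b * h1 ^ 2.
  by move=> ler r0 le; apply: Fitting_step_bound i2 le r0 => //; apply: ltnW.
have B1 r a b : r <= q1 -> 0 < r -> a * (c1 + (r - 1)) <= b * h1 ^ 2 -> r * a * c0 <= b * h0 ^ 2.
  by move=> ler r0 le; apply: Fitting_step_bound i1 le r0 => //; apply: ltnW.
clear i1 i2 i3 i4.
have {}le4 : 6 <= h3.
  apply: leq_trans le4; case: (ltngtP q4 2) => q4_2; first by rewrite ltnNge g4 in q4_2.
    exact: (@leq_mul 2 3).
  by rewrite q4_2 (@leq_mul 3 2) ?gt2.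
have {}le3 : 12 <= h2 by apply: leq_trans le3; apply: (@leq_mul 6 2).
have {}le2 : 24 <= h1 by apply: leq_trans le2; apply: (@leq_mul 12 2).
have s4 : 4 <= h4 ^ 2 by rewrite -[4]/(2 ^ 2) leq_exp2r.
have s3 : 36 <= h3 ^ 2 by rewrite -[36]/(6 ^ 2) leq_exp2r.
have s2 : 100 <= h2 ^ 2 by rewrite -[100]/(10 ^ 2) leq_exp2r // (leq_trans _ le3).
have s1 : 100 <= h1 ^ 2 by rewrite -[100]/(10 ^ 2) leq_exp2r // (leq_trans _ le2).
have s4' : q4 = 2 -> 9 <= h4 ^ 2 by move/gt2=> gt3; rewrite -[9]/(3 ^ 2) leq_exp2r.
move: (h4 ^ 2) (h3 ^ 2) (h2 ^ 2) (h1 ^ 2) (h0 ^ 2) => x4 x3 x2 x1 x0 in c4h B4 B3 B2 B1 s4 s3 s2 s1 s4' *.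
clear gt1 gt2 le1 le2 le3 le4 h3_gt0 h2_gt0 h1_gt0 h4_gt0 c4_gt0 c3_gt0 c2_gt0 c1_gt0.
have e4' : q4 != 2 -> 2 * c3 <= x3.
  move=> q4_2; have q4_3 : 2 < q4 by rewrite ltn_neqAle eq_sym q4_2.
  by have := B4 3 2 3 q4_3 isT; clear -c4h s4; lia.
(* For q4 = 2 use c4 <= x4 and x4 >= 9, which give 9 (c4 + 1) <= 10 x4; for larger q4 the ratio is
   already at most 1/2. *)
have e4 : 9 * c3 <= 5 * x3.
  have [q4_2|q4_2] := eqVneq q4 2; last by have := e4' q4_2; clear; lia.
  have := B4 2 9 10 g4 isT; have := s4' q4_2; clear -c4h; lia.
(* The cases follow the places of the prime 2; its neighbours are at least 3. Each [B] turns a (c +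
   r - 1) <= b x one level down into r a c <= b x, and r a reaches 16 or 18 with b = 1 at the
   top. *)
have [q3_2|q3_2] := eqVneq q3 2.
  have q4_n2 : q4 != 2 by rewrite -q3_2.
  have q2_3 : 2 < q2 by rewrite ltn_neqAle g2 andbT eq_sym -q3_2 eq_sym.
  have {}e4' := e4' q4_n2.
  have e3 : 72 * c2 <= 19 * x2 by have := B3 2 36 19 g3 isT; clear -s3 e4'; lia.
  have e2 : 10 * c1 <= x1 by have := B2 3 10 3 q2_3 isT; clear -s2 e3; lia.
  by have := B1 2 8 1 g1 isT; clear -s1 e2; lia.
have q3_3 : 2 < q3 by rewrite ltn_neqAle g3 eq_sym q3_2.
have e3 : 54 * c2 <= 11 * x2 by have := B3 3 18 11 q3_3 isT; clear -s3 e4; lia.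
have [q2_2|q2_2] := eqVneq q2 2.
  have q1_3 : 2 < q1 by rewrite ltn_neqAle g1 andbT eq_sym -q2_2 eq_sym.
  have e2 : 8 * c1 <= x1 by have := B2 2 4 1 g2 isT; clear -s2 e3; lia.
  by have := B1 3 6 1 q1_3 isT; clear -s1 e2; lia.
have q2_3 : 2 < q2 by rewrite ltn_neqAle g2 eq_sym q2_2.
have e2 : 12 * c1 <= x1 by have := B2 3 4 1 q2_3 isT; clear -s2 e3; lia.
by have := B1 2 8 1 g1 isT; clear -s1 e2; lia.
Qed.

Import Order.TTheory GRing.Theory Num.Theory.
Local Open Scope ring_scope.
Local Open Scope nat_scope.

(** * Degree sums *)

(** Degrees as natural numbers leave the estimates to integer arithmetic; [irr1E] links them to
    character values. *)
Definition ideg (gT : finGroupType) (G : {group gT}) (i : Iirr G) : nat :=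
  irr_degree (socle_of_Iirr i).

Section Degrees.

Variables (gT : finGroupType) (G : {group gT}).
Implicit Type i : Iirr G.

Lemma irr1E i : 'chi_i 1%g = (ideg i)%:R.
Proof. exact: irr1_degree. Qed.

Lemma ideg_gt0 i : 0 < ideg i.
Proof. exact: irr_degree_gt0. Qed.

Lemma ideg0 : ideg (0%R : Iirr G) = 1.
Proof. by apply/eqP; rewrite -(eqr_nat algC) -irr1E irr0 cfun11. Qed.

Lemma sum_ideg_sqr : \sum_i ideg (i : Iirr G) ^ 2 = #|G|.
Proof.
apply/eqP; rewrite -(eqr_nat algC) -irr_sum_square natr_sum; apply/eqP.
by apply: eq_bigr => i _; rewrite irr1E natrX.
Qed.

Lemma ideg_dvd i : ideg i %| #|G|.
Proof. by have := dvd_irr1_cardG i; rewrite irr1E dvdC_nat. Qed.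

Lemma char_degree_sumE : char_degree_sum G = (\sum_i ideg (i : Iirr G))%:R%R.
Proof. by rewrite natr_sum; apply: eq_bigr => i _; rewrite irr1E. Qed.

Lemma char_degree_sum_gt :
  ((4%:R)^-1 * #|G|%:R < char_degree_sum G)%R = (#|G| < 4 * \sum_i ideg (i : Iirr G)).
Proof.
by rewrite char_degree_sumE mulrC ltr_pdivrMr ?ltr0n // -natrM ltr_nat mulnC.
Qed.

Lemma classes_large : #|G| < 4 * \sum_i ideg (i : Iirr G) -> #|G| < 16 * #|classes G|.
Proof.
suffices: 8 * \sum_i ideg (i : Iirr G) <= #|G| + 16 * #|classes G| by lia.
have -> : 16 * #|classes G| = \sum_(i : Iirr G) 16.
  by rewrite sum_nat_const card_ord NirrE mulnC.
rewrite -sum_ideg_sqr -big_split big_distrr /=; apply: leq_sum => i _.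
by have := (nat_Cauchy (ideg i) 4).1; lia.
Qed.

End Degrees.

Section Subgroup.

Variables (gT : finGroupType) (G H : {group gT}).
Hypothesis sHG : H \subset G.

(** Each irreducible character of G is a constituent of some Ind chi_j with j in S, whose degree is
    |G:H| chi_j(1). Leaving characters out of S is what later gives a saving when G fuses characters
    of a normal subgroup. *)
Lemma sum_ideg_sub (S : {set Iirr H}) :
    (forall i : Iirr G, exists2 j, j \in S & j \in irr_constt ('Res[H] 'chi[G]_i)) ->
  \sum_i ideg (i : Iirr G) <= #|G : H| * \sum_(j in S) ideg j.
Proof.
move=> sC; rewrite big_distrr /=.
apply: leq_trans (_ : \sum_(j in S) \sum_(i in irr_constt ('Ind[G] 'chi_j)) ideg i <= _).
  rewrite (exchange_big_dep xpredT) //=; apply: leq_sum => i _.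
  have [j Sj] := sC i; rewrite -constt_Ind_Res => ji.
  by rewrite (bigD1 j) ?Sj //= leq_addr.
apply: leq_sum => j _; rewrite -(ler_nat algC) natrM -irr1E -(cfInd1 _ sHG).
rewrite [leRHS](_ : _ = (\sum_(i in irr_constt ('Ind[G] 'chi_j)) '['Ind[G] 'chi_j, 'chi_i] *: 'chi_i)%R 1%g); last first.
  by rewrite -cfun_sum_constt.
rewrite sum_cfunE natr_sum; apply: ler_sum => i ci.
rewrite cfunE -irr1E ler_peMl ?char1_ge0 ?irr_char //.
have := Cnat_cfdot_char_irr i (cfInd_char G (irr_char j)).
by case/natrP=> n defn; move: ci; rewrite irr_consttE defn ler1n pnatr_eq0 lt0n.
Qed.

Lemma sum_ideg_sub_all :
  \sum_i ideg (i : Iirr G) <= #|G : H| * \sum_j ideg (j : Iirr H).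
Proof.
have <- : \sum_(j in [set: Iirr H]) ideg j = \sum_j ideg (j : Iirr H).
  by apply: eq_bigl => j; rewrite inE.
apply: sum_ideg_sub => i; have [|j cj] := neq0_has_constt (phi := 'Res[H] 'chi_i).
  by rewrite Res_irr_neq0.
by exists j; rewrite ?inE.
Qed.

Lemma large_sum_sub :
  #|G| < 4 * \sum_i ideg (i : Iirr G) -> #|H| < 4 * \sum_j ideg (j : Iirr H).
Proof.
rewrite -(Lagrange sHG) mulnC => ltG.
rewrite -(ltn_pmul2l (indexg_gt0 G H)) (leq_trans ltG) // mulnCA leq_mul2l.
exact: sum_ideg_sub_all.
Qed.

End Subgroup.

(** * Perfect groups and their maximal normal subgroups *)

Section Perfect.

Variables (gT : finGroupType) (G : {group gT}).
Hypothesis perfG : G^`(1)%g = G.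

Lemma perfect_lin_irr (i : Iirr G) : ideg i = 1 -> i = 0%R.
Proof.
move=> d1; have lin_i : 'chi_i \is a linear_char.
  by rewrite qualifE /= irr_char irr1E d1 eqxx.
apply: irr_inj; rewrite irr0; apply/cfun_inP=> x Gx.
have := subsetP (lin_char_der1 lin_i) x; rewrite perfG => /(_ Gx) kx.
by rewrite cfker1 // lin_char1 // cfun1E Gx.
Qed.

Lemma perfect_det n (rG : mx_representation algC G n) x : x \in G -> \det (rG x) = 1%R.
Proof.
move=> Gx; have linD : detRepr rG \is a linear_char.
  by rewrite qualifE /= cfRepr_char cfRepr1 eqxx.
have := subsetP (lin_char_der1 linD) x; rewrite perfG => /(_ Gx) kx.
have := cfker1 kx; rewrite (lin_char1 linD) cfunE Gx mulr1n.
by rewrite /= mxtrace_scalar mulr1n.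
Qed.

(** One change of basis diagonalises x, hence all its powers; the determinant is a linear character,
    so it is trivial on a perfect group. *)
Lemma irr_eigenvalues (i : Iirr G) x : x \in G ->
  exists e : 'I_(ideg i) -> algC,
  [/\ (forall m, 'chi_i (x ^+ m)%g = \sum_k e k ^+ m)%R,
      (\prod_k e k = 1)%R, (forall k, `|e k| = 1)%R &
      forall m, (x ^+ m)%g \in cfker 'chi_i -> forall k, (e k ^+ m = 1)%R].
Proof.
move=> Gx; have [e [[B uB rx] [eX e1] _ _]] := repr_rsim_diag 'Chi_i Gx.
have rxm m : 'Chi_i (x ^+ m)%g = (invmx B *m diag_mx (\row_k (e 0 k) ^+ m) *m B)%R.
  elim: m => [|m IHm].
    have -> : (\row_k e 0 k ^+ 0 = const_mx 1 :> 'rV[algC]__)%R.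
      by apply/rowP=> k; rewrite !mxE.
    by rewrite repr_mx1 diag_const_mx mulmx1 mulVmx.
  rewrite expgSr repr_mxM ?groupX // IHm rx !mulmxA mulmxK //.
  rewrite -(mulmxA (invmx B) (diag_mx _) (diag_mx _)) mulmx_diag; congr (_ *m diag_mx _ *m _)%R.
  by apply/rowP=> k; rewrite !mxE exprSr.
exists (fun k => e 0 k)%R; split=> //.
- move=> m; rewrite -irrRepr cfunE groupX // rxm mulr1n mxtrace_mulC mulKVmx // mxtrace_diag.
  by apply: eq_bigr => k _; rewrite mxE.
- rewrite -[RHS](perfect_det 'Chi_i Gx) rx !det_mulmx det_inv mulrC mulrA divrr -?unitmxE //.
  by rewrite mul1r det_diag.
move=> m; rewrite -irrRepr cfker_repr inE groupX //= mul1mx rxm => /eqP eq1 k.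
have : (diag_mx (\row_k e 0 k ^+ m) = 1%:M :> 'M[algC]__)%R.
  rewrite -[LHS](mulKVmx uB) -[X in (_ *m X = _)%R](mulmxK uB) eq1.
  by rewrite mul1mx mulmxV.
by move/matrixP=> /(_ k k); rewrite !mxE eqxx.
Qed.

(* The eigenvalue -1 has even multiplicity because the determinant is 1. *)
Lemma irr_involution (i : Iirr G) x : x \in G -> (x ^+ 2)%g \in cfker 'chi_i ->
  exists2 m, ('chi_i x = (ideg i)%:R - (4 * m)%:R)%R & 2 * m <= ideg i.
Proof.
move=> Gx kx; have [e [ex pe _ ek]] := irr_eigenvalues i Gx.
have e2 k : (e k = 1 \/ e k = -1)%R.
  by have /eqP := ek 2 kx k; rewrite sqrf_eq1 => /orP[] /eqP; [left | right].
pose N := [set k | e k == -1]%R.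
have eE k : (e k = (-1) ^+ (k \in N))%R.
  rewrite inE; case: (e2 k) => ->; last by rewrite eqxx.
  by rewrite -addr_eq0 -(natrD _ 1 1) pnatr_eq0.
have evenN : ~~ odd #|N|.
  have pN : ((-1) ^+ #|N| = 1 :> algC)%R.
    rewrite -[RHS]pe (eq_bigr _ (fun k _ => eE k)) -prodr_const big_mkcond /=.
    by apply: eq_bigr => k _; case: (k \in N).
  by apply/negP=> oddN; have /eqP := pN; rewrite -signr_odd oddN expr1 eq_sym -addr_eq0 -(natrD _ 1 1) pnatr_eq0.
have defN : #|N| = 2 * #|N|./2 by rewrite mul2n -[LHS]odd_double_half (negPf evenN).
exists #|N|./2; last by rewrite -defN -[leqRHS]card_ord max_card.
have -> : ((4 * #|N|./2)%:R = 2%:R * #|N|%:R :> algC)%R by rewrite -natrM [X in 2 * X]defN mulnA.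
have -> : ((ideg i)%:R = \sum_(k < ideg i) 1 :> algC)%R by rewrite sumr_const card_ord.
have -> : (#|N|%:R = \sum_k (if k \in N then 1 else 0) :> algC)%R.
  by rewrite -sum1_card natr_sum big_mkcond.
rewrite mulr_sumr -sumrB -[x]expg1 ex.
apply: eq_bigr => k _; rewrite eE expr1; case: (k \in N); last by rewrite mulr0 subr0.
by rewrite expr1 mulr1 [(2%:R)%R](natrD _ 1 1) opprD addrA subrr sub0r.
Qed.

End Perfect.

Lemma perfect_full_ker (gT : finGroupType) (G : {group gT}) (i : Iirr G) :
  G^`(1)%g = G -> cfker 'chi_i = G -> i = 0%R.
Proof.
move=> perfG kG; apply: perfect_lin_irr => //; apply/eqP.
have : 'chi_i \is a linear_char by rewrite lin_irr_der1 kG der_sub.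
by move/lin_char1; rewrite irr1E => /eqP; rewrite -[X in _ == X]/(1%:R)%R eqr_nat.
Qed.

(** * Degrees and class numbers of nonabelian simple groups *)

Section Simple.

Variables (gT : finGroupType) (L : {group gT}).
Hypotheses (simL : simple L) (nabL : ~~ abelian L).

Lemma simple_perfect : L^`(1)%g = L.
Proof.
have [_ /(_ _ (der_normal 1 L))[L'1|//]] := simpleP _ simL.
by case/negP: nabL; apply/commG1P; rewrite -derg1 L'1.
Qed.

Lemma simple_fful (i : Iirr L) : i != 0%R -> cfker 'chi_i = 1%g.
Proof.
move=> nz_i; have [_ /(_ _ (cfker_normal 'chi_i))[//|kL]] := simpleP _ simL.
by case/eqP: nz_i; apply: perfect_full_ker kL; apply: simple_perfect.
Qed.

Lemma simple_center1 : 'Z(L) = 1%g.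
Proof.
have [_ /(_ _ (center_normal L))[//|ZL]] := simpleP _ simL.
by case/negP: nabL; rewrite -[X in abelian X]ZL center_abelian.
Qed.

(** Since the degree divides |L|, there is an involution. With determinant 1 in degree 2 it acts as
    1 or -1, so it lies in the kernel or the centre, both trivial. *)
Lemma simple_ideg_neq2 (i : Iirr L) : ideg i != 2.
Proof.
apply/eqP=> di2; have nz_i : i != 0%R by apply: contraTneq isT => i0; move: di2; rewrite i0 ideg0.
have d2 : 2 %| #|L| by rewrite -di2 ideg_dvd.
have [x Lx ox] := Cauchy (isT : prime 2) d2.
have ker_i := simple_fful nz_i.
have kx : (x ^+ 2)%g \in cfker 'chi_i by rewrite -ox expg_order group1.
have [m xm le_m] := irr_involution simple_perfect Lx kx.
have ntx : x != 1%g by rewrite -order_gt1 ox.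
rewrite di2 in xm le_m; case: m le_m xm => [|[|m]] le_m xm; last by lia.
  case/negP: ntx; apply/eqP/set1gP; rewrite -ker_i cfkerEirr inE xm irr1E di2.
  by rewrite muln0 subr0.
case/negP: ntx; apply/eqP/set1gP; rewrite -simple_center1.
rewrite -(cfcenter_fful_irr (i := i)); last by rewrite /cfaithful ker_i.
rewrite irr_cfcenterE // irr1E di2 xm muln1 -opprB normrN -natrB //.
by rewrite normr_nat eqxx.
Qed.

Lemma simple_ideg_ge3 (i : Iirr L) : i != 0%R -> 3 <= ideg i.
Proof.
move=> nz_i; have := ideg_gt0 i; have := simple_ideg_neq2 i.
have : ideg i != 1 by apply: contraNneq nz_i => /(perfect_lin_irr simple_perfect)->.
lia.
Qed.

(** Nontrivial degrees are at least 3, so |L| >= 9 k(L) - 8. They are not all 3, since then |L| = 1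
    mod 9 would be divisible by 3; a degree of at least 4 adds 16 - 9 = 7 and gives |L| >= 17. *)
Lemma simple_classes_le : 9 * #|classes L| <= #|L| + 1 /\ 17 <= #|L|.
Proof.
have L1 : #|L| = 1 + \sum_(i | i != 0%R :> Iirr L) ideg i ^ 2.
  by rewrite -sum_ideg_sqr (bigD1 (0%R : Iirr L)) //= ideg0.
have kE : 9 * #|classes L| = 9 + \sum_(i | i != 0%R :> Iirr L) 9.
  have -> : #|classes L| = \sum_(i : Iirr L) 1 by rewrite sum_nat_const card_ord NirrE muln1.
  by rewrite (bigD1 (0%R : Iirr L)) //= mulnDr big_distrr.
have Lgt1 : 1 < #|L| by rewrite cardG_gt1; case/simpleP: simL.
have [/forallP all3|/forallPn[i]] := boolP [forall i : Iirr L, (i != 0%R) ==> (ideg i == 3)].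
  have L3 : #|L| = 1 + \sum_(i | i != 0%R :> Iirr L) 9.
    by rewrite L1; congr (_ + _); apply: eq_bigr => i nz; have := all3 i; rewrite nz => /eqP->.
  have [i nz_i|no] := pickP (fun i : Iirr L => i != 0%R); last first.
    by move: Lgt1; rewrite L3 big_pred0.
  have := ideg_dvd i; have := all3 i; rewrite nz_i L3 => /eqP-> /dvdnP[q].
  by rewrite sum_nat_const; lia.
rewrite negb_imply => /andP[nz_i ne3].
have gt3 : 4 <= ideg i by have := simple_ideg_ge3 nz_i; lia.
rewrite (bigD1 i) //= in L1; rewrite (bigD1 i) //= in kE.
pose S9 := \sum_(k : Iirr L | (k != 0%R) && (k != i)) 9.
pose S2 := \sum_(k : Iirr L | (k != 0%R) && (k != i)) ideg k ^ 2.
have {}L1 : #|L| = 1 + (ideg i ^ 2 + S2) := L1.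
have {}kE : 9 * #|classes L| = 9 + (9 + S9) := kE.
have le9 : S9 <= S2.
  by apply: leq_sum => k /andP[/simple_ideg_ge3 ge3 _]; rewrite -[9]/(3 ^ 2) leq_exp2r.
have : 16 <= ideg i ^ 2 by rewrite -[16]/(4 ^ 2) leq_exp2r.
move: S9 S2 => S9 S2 in L1 kE le9 *; lia.
Qed.

End Simple.

Lemma perfect_classes_le (gT : finGroupType) (G : {group gT}) :
  G^`(1)%g = G -> 4 * #|classes G| <= #|G| + 3.
Proof.
move=> perfG; have -> : #|classes G| = \sum_(i : Iirr G) 1 by rewrite sum_nat_const card_ord NirrE muln1.
rewrite -sum_ideg_sqr (bigD1 (0%R : Iirr G)) //= [in leqRHS](bigD1 (0%R : Iirr G)) //= ideg0.
rewrite mulnDr big_distrr /=.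
rewrite exp1n -[X in X + _ <= _]/(1 + 3) addnAC leq_add2r leq_add2l.
apply: leq_sum => i nz_i; rewrite -[4 * 1]/(2 ^ 2) leq_exp2r //.
rewrite ltn_neqAle ideg_gt0 andbT eq_sym.
by apply: contraNneq nz_i => /(perfect_lin_irr perfG)->.
Qed.

(** * Centrality of a maximal normal subgroup *)

Section MaxNormal.

Variables (gT : finGroupType) (P M : {group gT}).
Hypotheses (perfP : P^`(1)%g = P) (maxM : maxnormal M P P).

Lemma maxnormal_nsub : M <| P.
Proof. exact: maxnormal_normal. Qed.

Lemma maxnormal_quo_simple : simple (P / M).
Proof. by rewrite quotient_simple ?maxnormal_nsub. Qed.

Lemma maxnormal_quo_nabelian : ~~ abelian (P / M).
Proof.
have [ntL _] := simpleP _ maxnormal_quo_simple.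
apply: contra ntL => /commG1P; rewrite -[[~: _, _]]/((P / M)^`(1)%g) -quotient_der ?perfP => [/eqP//|].
exact: normal_norm maxnormal_nsub.
Qed.

Lemma maxnormal_mul (N : {group gT}) : N <| P -> ~~ (N \subset M) -> (M * N)%g = P.
Proof.
move=> nsNP sNM; apply/eqP; have [nsMP [sNP nNP]] := (maxnormal_nsub, andP nsNP).
have nMN := subset_trans sNP (normal_norm nsMP).
rewrite eqEproper mul_subG ?normal_sub // -norm_joinEr //.
apply: contra sNM => ltMN; have [_ /(_ (M <*> N)%G)] := maxgroupP maxM.
rewrite ltMN normsY ?normal_norm // joing_subl => /(_ isT isT) <-.
exact: joing_subr.
Qed.

(** Let C = C_P(M). If C lies in M, elements outside M centralise at most half of M, and the
    proportion for P is about 1/2 times 1/9, below 1/16. Otherwise P = MC. If C < P, then P/C is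
    perfect and isomorphic to M/(M meet C), and k(P) <= k(P/M) k(P/C) |M meet C| bounds the
    proportion by about 1/9 times 1/4. *)
Lemma maxnormal_central : #|P| < 16 * #|classes P| -> M \subset 'Z(P).
Proof.
have nsMP := maxnormal_nsub; have [sMP nMP] := andP nsMP.
have [kL Lge] := simple_classes_le maxnormal_quo_simple maxnormal_quo_nabelian.
have cP : #|P| = #|M| * #|(P / M)%g| by rewrite card_quotient // Lagrange.
move=> ltP; pose C := 'C_P(M)%G.
have nsCP : C <| P by rewrite norm_normalI ?norms_cent.
have [sCP nCP] := andP nsCP.
have [sCM|sCM] := boolP (C \subset M).
  have /(_ _)/wrap[x Px M'x|] := commuting_pairs_quo nsMP (m := 2).
    have sCMx : 'C_M[x] \subset M := subsetIl _ _.
    rewrite -(Lagrange sCMx) mulnC leq_mul2l; apply/orP; right.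
    rewrite indexg_gt1 subsetI subxx /=; apply: contra M'x => cMx.
    by apply: (subsetP sCM); rewrite inE Px -sub_cent1.
  rewrite !commuting_pairsE /=.
  rewrite /= in kL Lge cP; rewrite cP in ltP *; move: ltP kL Lge (cardG_gt0 M).
  move: #|M| #|(P / M)%g| #|classes P| #|classes (P / M)%g| => m l k kL ltP leL Lge m_gt0 le.
  have lt1 : (m * l) * (m * l) < 16 * k * (m * l) by rewrite ltn_pmul2r // muln_gt0 m_gt0; lia.
  have : m ^ 2 * (l * l) < m ^ 2 * (8 * (kL * l) + 8).
    rewrite mulnDr mulnCA -mulnn mulnACA in le *; lia.
  rewrite ltn_pmul2l ?expn_gt0 ?m_gt0 // => lt2; nia.
have defP : (M * C)%g = P by apply: maxnormal_mul.
have [CP|neqCP] := eqVneq C P.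
  by rewrite subsetI sMP centsC -CP subsetIr.
pose Z := (M :&: C)%G; have sZM : Z \subset M := subsetIl _ _.
have nsZM : Z <| M by rewrite (normalGI sMP).
have isoMZ : M / Z \isog P / C.
  rewrite /= setIC -[X in _ \isog X / _]defP; apply: weak_second_isog.
  exact: subset_trans sMP nCP.
have perfQ : (P / C)^`(1)%g = (P / C)%g by rewrite -quotient_der ?perfP.
have kQ := perfect_classes_le perfQ.
have ltQ : 1 < #|classes (P / C)%g|.
  rewrite classes_gt1 -subG1 quotient_sub1 //; apply: contra neqCP => sPC.
  by rewrite -val_eqE eqEsubset sCP sPC.
have cM : #|M| = #|Z| * #|(P / C)%g|.
  by rewrite -(card_isog isoMZ) card_quotient ?normal_norm // Lagrange.
have k1 := classes_quo_mul nsMP; have := classes_quo_mul nsZM.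
rewrite (nclasses_isog isoMZ) => k2; have k3 := card_classes_le Z.
suff: #|P| < #|P| by rewrite ltnn.
apply: leq_trans ltP _; rewrite cP cM.
move: kL Lge kQ ltQ k1 k2 k3; rewrite /=.
move: #|classes P| #|classes M| #|classes (P / M)%g| #|classes (P / C)%g| #|classes Z| => kP kM kL kQ kZ.
move: #|(P / M)%g| #|(P / C)%g| #|Z| => l q z leL Lge leQ ltQ k1 k2 k3.
have le1 : kP <= kL * (kQ * z).
  by rewrite (leq_trans k1) // leq_mul // (leq_trans k2) // leq_mul.
have le2 : 16 * (kL * kQ) <= q * l.
  have le36 : (9 * kL) * (4 * kQ) <= (l + 1) * (q + 3) by apply: leq_mul.
  have le5 : 5 * l <= q * l by rewrite leq_mul //; clear -leQ ltQ; lia.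
  have le17 : 17 * q <= q * l by rewrite mulnC leq_mul.
  have E1 : (9 * kL) * (4 * kQ) = 36 * (kL * kQ) by ring.
  have E2 : (l + 1) * (q + 3) = q * l + 3 * l + q + 3 by ring.
  rewrite E1 E2 in le36; move: (kL * kQ) (q * l) le36 le5 le17 => X Y; clear -Lge; lia.
apply: leq_trans (leq_mul (leqnn _) le1) _.
have -> : 16 * (kL * (kQ * z)) = z * (16 * (kL * kQ)) by ring.
by rewrite -mulnA leq_mul2l le2 orbT.
Qed.

End MaxNormal.

(** * Characters over a central subgroup *)

(** For M central this is Irr(P | chi_j), the characters lying over chi_j, because restriction to a
    central subgroup is homogeneous. *)
Definition central_block (gT : finGroupType) (P M : {group gT}) (j : Iirr M) : {set Iirr P} :=
  [set i | 'Res[M] 'chi[P]_i == 'chi_i 1%g *: 'chi_j]%R.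

Lemma cfRepr_scalarM (gT : finGroupType) (G : {group gT}) n
    (rG : mx_representation algC G n) x z c :
  x \in G -> z \in G -> rG z = (c%:M)%R -> (cfRepr rG (x * z)%g = cfRepr rG x * c)%R.
Proof.
move=> Gx Gz rz; rewrite !cfunE groupM // Gx repr_mxM // rz.
by rewrite mul_mx_scalar linearZ !mulr1n /= mulrC.
Qed.

Section CentralBlocks.

Variables (gT : finGroupType) (P M : {group gT}).
Hypothesis cMP : M \subset 'Z(P).

Local Notation block := (@central_block gT P M).

Lemma central_sub : M \subset P.
Proof. exact: subset_trans cMP (center_sub P). Qed.

Lemma central_normal : M <| P.
Proof. exact: sub_center_normal. Qed.

Lemma central_blockE i (j : Iirr M) z : i \in block j -> z \in M ->
  ('chi[P]_i z = 'chi_i 1%g * 'chi_j z)%R.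
Proof.
rewrite inE => /eqP Bi Mz.
by rewrite -(cfResE _ central_sub Mz) Bi cfunE.
Qed.

Lemma central_block_ex i : exists j, i \in block j.
Proof.
have [xi lin_xi def_xi] := cfcenter_Res 'chi[P]_i.
have sMZ : M \subset 'Z('chi_i)%CF.
  by rewrite (subset_trans cMP) // -cap_cfcenter_irr bigcap_inf.
have /irrP[j defj] := lin_char_irr (cfRes_lin_char M lin_xi).
exists j; rewrite inE -(cfResRes _ sMZ (cfcenter_sub _)) def_xi.
by rewrite -defj linearZ.
Qed.

Lemma central_block_uniq i j j' : i \in block j -> i \in block j' -> j = j'.
Proof.
rewrite !inE => /eqP-> /eqP /(scalerI (irr1_neq0 i)).
exact: irr_inj.
Qed.

Lemma central_block_scalar i j z : i \in block j -> z \in M ->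
  ('Chi_i z = ('chi_j z)%:M)%R.
Proof.
move=> Bij Mz; have Pz := subsetP central_sub z Mz.
have : z \in 'Z('chi_i)%CF.
  by rewrite (subsetP _ z Mz) // (subset_trans cMP) // -cap_cfcenter_irr bigcap_inf.
rewrite -irrRepr cfcenter_repr inE Pz /= => /is_scalar_mxP[c rz].
have := central_blockE Bij Mz; rewrite -irrRepr -[z]mul1g (cfRepr_scalarM _ _ rz) //.
rewrite mul1g irrRepr => /(mulfI (irr1_neq0 i)) <-; exact: rz.
Qed.

Lemma central_blockM i j x z : i \in block j -> x \in P -> z \in M ->
  ('chi_i (x * z)%g = 'chi_i x * 'chi_j z)%R.
Proof.
move=> Bij Px Mz; have Pz := subsetP central_sub z Mz.
by rewrite -irrRepr (cfRepr_scalarM _ _ (central_block_scalar Bij Mz)).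
Qed.

(** The left side is the determinant of the scalar by which z acts. Thus the order of chi_j(z)
    divides every degree in the block. *)
Lemma central_block_det i j z : P^`(1)%g = P -> i \in block j -> z \in M ->
  ('chi_j z ^+ ideg i = 1)%R.
Proof.
move=> perfP Bij Mz; rewrite -(perfect_det perfP 'Chi_i (subsetP central_sub z Mz)).
by rewrite (central_block_scalar Bij Mz) det_scalar.
Qed.

(** By Frobenius reciprocity. Evaluating the induced character off M, where it vanishes, and at 1
    gives the two orthogonality relations of the block. *)
Lemma central_block_Ind j : ('Ind[P] 'chi_j = \sum_(i in block j) 'chi_i 1%g *: 'chi_i)%R.
Proof.
rewrite [LHS]cfun_sum_cfdot [RHS]big_mkcond; apply: eq_bigr => i _ /=.
rewrite -Frobenius_reciprocity; have [j' Bij'] := central_block_ex i.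
have := Bij'; rewrite inE => /eqP->; rewrite cfdotZr cfdot_irr irr1E conjC_nat.
have [eqjj'|nejj'] := eqVneq j j'; first by rewrite eqjj' Bij' mulr1.
rewrite mulr0 scale0r; case: ifP => // Bij.
by case/eqP: nejj'; apply: central_block_uniq Bij Bij'.
Qed.

Lemma central_block_orth j x : x \in P -> x \notin M ->
  (\sum_(i in block j) 'chi_i 1%g * 'chi_i x = 0)%R.
Proof.
move=> Px M'x; have := cfun_on0 (cfInd_normal 'chi_j central_normal) M'x.
rewrite central_block_Ind sum_cfunE => sum0; rewrite -[RHS]sum0.
by apply: eq_bigr => i _; rewrite cfunE.
Qed.

Lemma central_block_sqr j : \sum_(i in block j) ideg i ^ 2 = #|P : M| * ideg j.
Proof.
apply/eqP; rewrite -(eqr_nat algC) natrM -irr1E -(cfInd1 _ central_sub).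
rewrite central_block_Ind sum_cfunE natr_sum; apply/eqP/eq_bigr => i _.
by rewrite cfunE irr1E natrX.
Qed.

End CentralBlocks.

Section IrrSeq.

Variables (gT : finGroupType) (G : {group gT}).
Implicit Types (i k : Iirr G) (r : seq (Iirr G)).

Lemma cfdot_irr_seq r k : ('[\sum_(i <- r) 'chi_i, 'chi_k] = (count_mem k r)%:R)%R.
Proof.
rewrite cfdot_suml; elim: r => [|i r IHr]; first by rewrite big_nil.
by rewrite big_cons IHr cfdot_irr natrD.
Qed.

Lemma irr_seq1 r : ((\sum_(i <- r) 'chi_i) 1%g = (\sum_(i <- r) ideg i)%:R)%R.
Proof. by rewrite sum_cfunE natr_sum; apply: eq_bigr => i _; rewrite irr1E. Qed.

Lemma mem_irr_seq_constt r k : k \in r -> k \in irr_constt (\sum_(i <- r) 'chi_i)%R.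
Proof.
by move=> rk; rewrite irr_consttE cfdot_irr_seq pnatr_eq0 -lt0n -has_count has_pred1.
Qed.

(** Both sides average the fourth power of the modulus of chi. *)
Lemma cfdot_mul_conj i :
  ('['chi_i * ('chi_i)^*%CF, 'chi_i * ('chi_i)^*%CF] = '['chi_i * 'chi_i, 'chi_i * 'chi_i])%R.
Proof.
rewrite !cfdotE; congr (_ * _)%R; apply: eq_bigr => x _.
by rewrite !cfunE !rmorphM /= conjCK; ring.
Qed.

Lemma irr_mul_conj_seq i : exists2 r : seq (Iirr G), 0%R \notin r &
  ('chi_i * ('chi_i)^*%CF = 1 + \sum_(k <- r) 'chi_k)%R.
Proof.
have /char_sum_irr[r0 def_r0] : ('chi_i * ('chi_i)^*%CF)%R \is a character.
  by rewrite rpredM ?cfConjC_char ?irr_char.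
have c0 : count_mem 0%R r0 = 1.
  apply/eqP; rewrite -(eqr_nat algC) -cfdot_irr_seq -def_r0 irr0; apply/eqP.
  rewrite -(cfnorm_irr i) !cfdotE; congr (_ * _)%R; apply: eq_bigr => x Gx.
  by rewrite !cfunE cfun1E Gx rmorph1 mulr1.
have r00 : 0%R \in r0 by rewrite -has_pred1 has_count c0.
have pr := perm_to_rem r00; exists (rem 0%R r0).
  rewrite -has_pred1 has_count -leqNgt leqn0.
  have /seq.permP/(_ (pred1 0%R))/= := pr; by rewrite c0 add1n => -[<-].
by rewrite def_r0 (perm_big _ pr) big_cons irr0.
Qed.

End IrrSeq.

(** * A real character of degree 3 *)

Section RealCharacter.

Variables (gT : finGroupType) (P M : {group gT}).
Hypotheses (perfP : P^`(1)%g = P) (maxM : maxnormal M P P).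
Hypothesis bigP : #|P| < 4 * \sum_i ideg (i : Iirr P).

Let cMP : M \subset 'Z(P) := maxnormal_central perfP maxM (classes_large bigP).
Let sMP := central_sub cMP.
Let nsMP := central_normal cMP.
Local Notation block := (@central_block gT P M).

Lemma central_lin_char (j : Iirr M) : 'chi_j \is a linear_char.
Proof.
apply: (char_abelianP M _).
by rewrite abelianE (subset_trans sMP) // centsC (subset_trans cMP) ?subsetIr.
Qed.

Lemma block_sum_sqr j : \sum_(i in block j) ideg i ^ 2 = #|P : M|.
Proof.
rewrite central_block_sqr //; suff -> : ideg j = 1 by rewrite muln1.
by apply/eqP; rewrite -(eqr_nat algC) -irr1E (lin_char1 (central_lin_char j)).
Qed.

Lemma sum_central_blocks (F : Iirr P -> nat) : \sum_i F i = \sum_j \sum_(i in block j) F i.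
Proof.
rewrite (exchange_big_dep xpredT) //=; apply: eq_bigr => i _.
have [j Bij] := central_block_ex cMP i.
rewrite (big_pred1 j) // => j'; apply/idP/eqP => [Bij'|->//].
exact: central_block_uniq Bij' Bij.
Qed.

(** There are |M| blocks, since M is abelian, and together they have degree sum above |P|/4 = |M|
    |P:M|/4. *)
Lemma positive_central_block : exists j : Iirr M, #|P : M| < 4 * \sum_(i in block j) ideg i.
Proof.
apply/existsP; apply: contraLR bigP => /existsPn noj; rewrite -leqNgt.
rewrite sum_central_blocks big_distrr /=.
have -> : #|P| = \sum_(j : Iirr M) #|P : M|.
  rewrite sum_nat_const (card_Iirr_abelian _) ?Lagrange //.
  by rewrite abelianE (subset_trans sMP) // centsC (subset_trans cMP) ?subsetIr.
by apply: leq_sum => j _; rewrite leqNgt noj.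
Qed.

(** As P = MN with M abelian, P/N is abelian and the perfect group P equals N. *)
Lemma maxnormal_normal_full (N : {group gT}) : N <| P -> ~~ (N \subset M) -> N :=: P.
Proof.
move=> nsNP sNM; have defP := maxnormal_mul maxM nsNP sNM.
have [sNP nNP] := andP nsNP; apply/eqP; rewrite eqEsubset sNP /= -{1}perfP.
apply: der1_min => //; rewrite -defP quotientMidr quotient_abelian //.
by rewrite abelianE (subset_trans sMP) // centsC (subset_trans cMP) ?subsetIr.
Qed.

Lemma ideg_dvd_index (i : Iirr P) : ideg i %| #|P : M|.
Proof.
have := dvd_irr1_index_center i; rewrite irr1E dvdC_nat => /dvdn_trans-> //.
by apply: indexgS; rewrite (subset_trans cMP) // -cap_cfcenter_irr bigcap_inf.
Qed.

Lemma block0P (i : Iirr P) : (i \in block 0%R) = (M \subset cfker 'chi_i).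
Proof.
rewrite inE irr0; apply/eqP/idP => [Bi | kM].
  apply/subsetP=> z Mz; rewrite cfkerEirr inE -(cfResE _ sMP Mz) Bi cfunE cfun1E Mz mulr1.
  exact: eqxx.
apply/cfun_inP=> z Mz; rewrite (cfResE _ sMP Mz) cfunE cfun1E Mz mulr1.
by apply: cfker1; apply: (subsetP kM).
Qed.

(** On the central subgroup M the modulus of chi is constantly chi(1), so M lies in the kernel of
    the product of chi and its conjugate. *)
Lemma irr_mul_conj_ker i r : ('chi[P]_i * ('chi_i)^*%CF = 1 + \sum_(k <- r) 'chi_k)%R ->
  forall k, k \in r -> M \subset cfker 'chi_k.
Proof.
move=> def_r k rk; have [j Bij] := central_block_ex cMP i.
have Nr : (\sum_(k <- r) 'chi_k)%R \is a character by apply: rpred_sum => h _; apply: irr_char.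
apply: subset_trans (cfker_constt Nr (mem_irr_seq_constt rk)).
apply/subsetP=> z Mz; rewrite cfkerEchar // inE (subsetP sMP) //=.
have def_s x : ((\sum_(k <- r) 'chi_k) x = 'chi_i x * ('chi_i x)^* - (1 : 'CF(P)) x)%R.
  by have /cfunP/(_ x) := def_r; rewrite !cfunE => ->; rewrite addrC addKr.
rewrite !def_s !cfun1E group1 (subsetP sMP) // (central_blockE cMP Bij Mz) rmorphM /=.
by rewrite mulrACA -(normCK ('chi_j z)) normC_lin_char ?central_lin_char // expr1n mulr1.
Qed.

Lemma mul_conj_ideg (i : Iirr P) r : ('chi_i * ('chi_i)^*%CF = 1 + \sum_(k <- r) 'chi_k)%R ->
  \sum_(k <- r) ideg k = ideg i ^ 2 - 1.
Proof.
move=> /cfunP/(_ 1%g); rewrite !cfunE irr_seq1 irr1E cfun1E group1 rmorph_nat -natrM.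
by rewrite -(natrD _ 1) => /eqP; rewrite eqr_nat mulnn => /eqP->; rewrite addKn.
Qed.

Lemma mul_conj_real (i k : Iirr P) r : ('chi_i * ('chi_i)^*%CF = 1 + \sum_(k <- r) 'chi_k)%R ->
  0%R \notin r -> k \in r -> conjC_Iirr k \in r.
Proof.
move=> def_r r0 rk; rewrite -has_pred1 has_count.
have nz_k : conjC_Iirr k != 0%R by rewrite conjC_Iirr_eq0; apply: contraNneq r0 => <-.
have cnt h : h != 0%R -> (count_mem h r)%:R%R = '['chi_i * ('chi_i)^*%CF, 'chi_h]%R.
  by move=> nz_h; rewrite def_r cfdotDl cfdot_irr_seq -irr0 cfdot_irr eq_sym (negPf nz_h) add0r.
have realm : ('chi_i * ('chi_i)^*%CF)%R^*%CF = ('chi_i * ('chi_i)^*%CF)%R.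
  by apply/cfunP=> x; rewrite !cfunE rmorphM /= conjCK mulrC.
rewrite -(ltr_nat algC) cnt // conjC_IirrE cfdot_conjCr realm.
rewrite -cnt; last by apply: contraNneq r0 => <-.
by rewrite conjC_nat ltr0n -has_count has_pred1.
Qed.

(** Removing 1 from the product of chi and its conjugate leaves a real character of degree 3 without
    linear constituents, hence irreducible. *)
Lemma real_irr3_of_deg2 (i : Iirr P) : ideg i = 2 ->
  exists k : Iirr P, [/\ ideg k = 3, M \subset cfker 'chi_k & conjC_Iirr k = k].
Proof.
move=> di; have [r r0 def_r] := irr_mul_conj_seq i.
have := mul_conj_ideg def_r; rewrite di => sum_r.
have ge2 k : k \in r -> 2 <= ideg k.
  move=> rk; rewrite ltn_neqAle ideg_gt0 andbT eq_sym.
  by apply: contraNneq r0 => /(perfect_lin_irr perfP) <-.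
case: r => [|k [|k' r]] in r0 def_r sum_r ge2 *.
- by rewrite big_nil in sum_r.
- exists k; rewrite big_cons big_nil addn0 in sum_r; split=> //.
    by apply: (irr_mul_conj_ker def_r); rewrite inE.
  by have := mul_conj_real def_r r0 (mem_head _ _); rewrite inE => /eqP.
have := ge2 k (mem_head _ _); have := ge2 k'; rewrite !inE eqxx orbT => /(_ isT).
by rewrite !big_cons in sum_r; lia.
Qed.

Lemma index_maxnormal_gt1 : 1 < #|P : M|.
Proof. by rewrite indexg_gt1 proper_subn // (maxnormal_proper maxM). Qed.

Section NoDegree2.

Hypothesis no2 : forall i : Iirr P, ideg i != 2.

Lemma ideg_ge3 (i : Iirr P) : i != 0%R -> 3 <= ideg i.
Proof.
move=> nz_i; have := ideg_gt0 i; have := no2 i.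
have : ideg i != 1 by apply: contraNneq nz_i => /(perfect_lin_irr perfP)->.
lia.
Qed.

(** The block has positive sum of d (4 - d). Without degree 3, only the trivial character
    contributes positively, namely 3; a degree d >= 5 would cost d (d - 4) >= 5. So all other
    degrees are 4 and |P:M| = 1 mod 16, although 4 divides it. *)
Lemma positive_block_deg3 : exists j : Iirr M, exists i : Iirr P,
  [/\ #|P : M| < 4 * \sum_(i in block j) ideg i, i \in block j & ideg i = 3].
Proof.
have [j pos_j] := positive_central_block; exists j.
have [i /andP[Bi /eqP di]|no3] := pickP (fun i => (i \in block j) && (ideg i == 3)).
  by exists i.
exfalso; have ge4 i : i \in block j -> i != 0%R -> 4 <= ideg i.
  move=> Bi nz_i; have := ideg_ge3 nz_i; rewrite leq_eqVlt eq_sym => /orP[d3|//].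
  by have := no3 i; rewrite Bi d3.
have sqr := block_sum_sqr j.
have [B0|B'0] := boolP (0%R \in block j); last first.
  suff: 4 * \sum_(i in block j) ideg i <= #|P : M| by rewrite leqNgt pos_j.
  rewrite -sqr big_distrr /=; apply: leq_sum => i Bi; rewrite -mulnn leq_mul2r ge4 ?orbT //.
  by apply: contraNneq B'0 => <-.
have S1 : #|P : M| = 1 + \sum_(i in block j | i != 0%R) ideg i ^ 2.
  by rewrite -sqr (bigD1 _ B0) /= ideg0.
have S2 : \sum_(i in block j) ideg i = 1 + \sum_(i in block j | i != 0%R) ideg i.
  by rewrite (bigD1 _ B0) /= ideg0.
have eq4 i : i \in block j -> i != 0%R -> ideg i = 4.
  move=> Bi nz_i; have ge_i := ge4 i Bi nz_i.
  have Bi' : (i \in block j) && (i != 0%R) by rewrite Bi.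
  pose A1 := \sum_(k in block j | (k != 0%R) && (k != i)) ideg k.
  pose A2 := \sum_(k in block j | (k != 0%R) && (k != i)) ideg k ^ 2.
  have E1 : \sum_(i in block j | i != 0%R) ideg i = ideg i + A1.
    by rewrite (bigD1 i Bi') /=; congr (_ + _); apply: eq_bigl => k; rewrite andbA.
  have E2 : \sum_(i in block j | i != 0%R) ideg i ^ 2 = ideg i ^ 2 + A2.
    by rewrite (bigD1 i Bi') /=; congr (_ + _); apply: eq_bigl => k; rewrite andbA.
  have leA : 4 * A1 <= A2.
    rewrite big_distrr /=; apply: leq_sum => k /and3P[Bk nz_k _].
    by rewrite -mulnn leq_mul2r ge4 ?orbT.
  rewrite S1 S2 E1 E2 in pos_j; rewrite -mulnn in pos_j.
  move: leA pos_j ge_i; clear E1 E2; move: A1 A2 (ideg i) => A1 A2 d; clear; nia.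
have S3 : #|P : M| = 1 + 4 * (\sum_(i in block j | i != 0%R) 4).
  rewrite S1 big_distrr /=; congr (_ + _); apply: eq_bigr => i /andP[Bi nz_i].
  by rewrite eq4.
have [i /andP[Bi nz_i]|noi] := pickP [pred i | (i \in block j) && (i != 0%R)]; last first.
  by move: index_maxnormal_gt1; rewrite S1 big_pred0.
have := ideg_dvd_index i; rewrite (eq4 i Bi nz_i) S3.
by rewrite dvdn_addl ?dvdn_mulr.
Qed.

(** All degrees are odd, and 8 is a sum of odd numbers >= 3 only as 3 + 5; the constituent of degree
    3 is then alone of its degree and so real. *)
Lemma real_irr3_odd (i : Iirr P) : odd #|P : M| -> ideg i = 3 ->
  exists k : Iirr P, [/\ ideg k = 3, M \subset cfker 'chi_k & conjC_Iirr k = k].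
Proof.
move=> oddL di; have [r r0 def_r] := irr_mul_conj_seq i.
have := mul_conj_ideg def_r; rewrite di => sum_r.
have ge3 k : k \in r -> 3 <= ideg k.
  by move=> rk; apply: ideg_ge3; apply: contraNneq r0 => <-.
have odd_r (k : Iirr P) : odd (ideg k) by apply: dvdn_odd (ideg_dvd_index k) oddL.
have real3 k k' : r =i [:: k; k'] -> ideg k = 3 -> ideg k' = 5 ->
    exists k : Iirr P, [/\ ideg k = 3, M \subset cfker 'chi_k & conjC_Iirr k = k].
  move=> defr dk dk'; have rk : k \in r by rewrite defr mem_head.
  exists k; split=> //; first by apply: (irr_mul_conj_ker def_r).
  have := mul_conj_real def_r r0 rk; rewrite defr !inE => /orP[/eqP//|/eqP eqk'].
  have /eqP := irr1E (conjC_Iirr k); rewrite conjC_IirrE cfunE irr1E rmorph_nat eqr_nat.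
  by rewrite eqk' dk dk'.
case: r => [|k [|k' [|k'' r]]] in r0 def_r sum_r ge3 real3 *.
- by rewrite big_nil in sum_r.
- by have := odd_r k; rewrite big_cons big_nil addn0 in sum_r; rewrite sum_r.
- rewrite !big_cons big_nil addn0 in sum_r.
  have k3 : 3 <= ideg k by rewrite ge3 // !inE eqxx.
  have k'3 : 3 <= ideg k' by rewrite ge3 // !inE eqxx orbT.
  have ok := odd_r k; have ok' := odd_r k'.
  have [|] : (ideg k = 3 /\ ideg k' = 5) \/ (ideg k' = 3 /\ ideg k = 5).
    move: (ideg k) (ideg k') sum_r k3 k'3 ok ok' => a b /eqP; clear.
    by case: a => [|[|[|[|[|[|a]]]]]] //; case: b => [|[|[|[|[|[|b]]]]]] // eq_ab; auto; lia.
  - by case; apply: real3.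
  - by case; apply: real3 => h; rewrite !inE orbC.
have d1 : 3 <= ideg k by rewrite ge3 // !inE eqxx.
have d2 : 3 <= ideg k' by rewrite ge3 // !inE eqxx orbT.
have d3 : 3 <= ideg k'' by rewrite ge3 // !inE eqxx !orbT.
move: sum_r; rewrite !big_cons; clear -d1 d2 d3; lia.
Qed.

(** The 2-part of any preimage of an involution has the same image. *)
Lemma quo_involution_lift : ~~ odd #|P : M| ->
  exists x, [/\ x \in P, x \notin M, (x ^+ 2)%g \in M & 2.-elt x].
Proof.
have nMP := normal_norm nsMP.
rewrite -dvdn2 -card_quotient // => d2; have [xb /morphimP[y Ny Py ->] oy] := Cauchy (isT : prime 2) d2.
have cy : coset M (y.`_2)%g = coset M y.
  rewrite morph_constt //; apply: constt_p_elt; by rewrite /p_elt oy pnat_id.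
have Nx : (y.`_2)%g \in 'N(M) by rewrite groupX.
exists (y.`_2)%g; split; last exact: p_elt_constt.
- by rewrite groupX.
- apply/negP=> Mx; have := coset_id Mx; rewrite cy => y1.
  by move: oy; rewrite /= y1 order1.
apply: coset_idr; first by rewrite groupX.
by rewrite morphX //= cy -oy expg_order.
Qed.

Section EvenOrder.

Variables (j : Iirr M) (i : Iirr P) (x : gT).
Hypotheses (pos_j : #|P : M| < 4 * \sum_(i in block j) ideg i).
Hypotheses (Bi : i \in block j) (di : ideg i = 3).
Hypotheses (Px : x \in P) (M'x : x \notin M) (Mx2 : (x ^+ 2)%g \in M) (x2 : 2.-elt x).

(** The value of chi_j at x^2 is a cube root of unity, by the determinant in degree 3, and also has
    2-power order; so it is 1. *)
Lemma block_sqr_in_ker k : k \in block j -> (x ^+ 2)%g \in cfker 'chi_k.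
Proof.
move=> Bk; have linj := central_lin_char j.
have lam3 : ('chi_j (x ^+ 2)%g ^+ 3 = 1)%R by rewrite -di; apply: central_block_det Bi Mx2.
have [a oa] : exists a, #[(x ^+ 2)%g] = 2 ^ a.
  have [a ->] := p_natP (mem_p_elt (x2 : 2.-group <[x]>) (mem_cycle x 2)); by exists a.
have lam2 : ('chi_j (x ^+ 2)%g ^+ (2 ^ a) = 1)%R.
  by rewrite -lin_charX // -oa expg_order lin_char1.
have lam1 : ('chi_j (x ^+ 2)%g = 1)%R.
  have := expr_mod (2 ^ a) lam3; rewrite lam2; have : 2 ^ a %% 3 < 3 by rewrite ltn_mod.
  have : 2 ^ a %% 3 != 0.
    by rewrite -[_ == 0]/(3 %| 2 ^ a) Euclid_dvdX.
  case: (2 ^ a %% 3) => [|[|[|//]]] // _ _.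
  by move=> l2; move: lam3; rewrite exprS l2 mulr1.
have Px2 := subsetP sMP _ Mx2.
by rewrite cfkerEirr inE (central_blockE cMP Bk Mx2) lam1 mulr1.
Qed.

Lemma block_value_ex k : k \in block j -> k != 0%R ->
  exists m, ('chi_k x = (ideg k)%:R - 4%:R - (4 * m)%:R)%R.
Proof.
move=> Bk nz_k; have [[|m] xm _] := irr_involution perfP Px (block_sqr_in_ker Bk); last first.
  by exists m; rewrite xm mulnS natrD opprD addrA.
case/eqP: nz_k; apply: (perfect_full_ker perfP).
apply: (maxnormal_normal_full (N := cfker_group 'chi_k)) (cfker_normal _) _.
apply: contra M'x => /subsetP-> //.
by rewrite /= cfkerEirr inE xm muln0 subr0 irr1E.
Qed.

(* The integers d (d - 4 - chi x), with d = chi 1, are nonnegative multiples of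
   4 for chi != 1; by orthogonality they sum to less than 4 over the
   nonprincipal part of the block, so all vanish. *)
Lemma block_value : 0%R \in block j /\
  (forall k, k \in block j -> k != 0%R -> ('chi_k x = (ideg k)%:R - 4%:R)%R).
Proof.
pose c (k : Iirr P) := ((ideg k)%:R * ((ideg k)%:R - 4%:R - 'chi_k x) : algC)%R.
have c_ge0 k : k \in block j -> k != 0%R -> (0 <= c k)%R.
  move=> Bk nz_k; have [m xm] := block_value_ex Bk nz_k.
  by rewrite /c xm opprB addrCA subrr addr0 -natrM ler0n.
have sum_c : (\sum_(k in block j) c k < 0)%R.
  have -> : (\sum_(k in block j) c k = #|P : M|%:R - (4 * \sum_(k in block j) ideg k)%:R)%R.
    rewrite -(block_sum_sqr j) natrM !natr_sum mulr_sumr -[RHS]subr0.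
    rewrite -[X in (_ = _ - X)%R](central_block_orth cMP j Px M'x) -!sumrB.
    by apply: eq_bigr => k _; rewrite /c irr1E natrX; ring.
  by rewrite subr_lt0 ltr_nat.
have B0 : 0%R \in block j.
  apply: contraLR sum_c => B'0; rewrite -real_leNgt ?rpred0 //.
    by apply: sumr_ge0 => k Bk; apply: c_ge0 => //; apply: contraNneq B'0 => <-.
  apply: rpred_sum => k Bk; apply: ger0_real; apply: c_ge0 => //.
  by apply: contraNneq B'0 => <-.
split=> // k Bk nz_k; have [m xm] := block_value_ex Bk nz_k.
have c0 : (c 0 = - 4%:R)%R.
  by rewrite /c ideg0 irr0 cfun1E Px mul1r addrAC subrr sub0r.
move: sum_c; rewrite (bigD1 _ B0) /= c0 addrC subr_lt0 => lt4.
have le_c : (c k <= \sum_(k in block j | k != 0) c k)%R.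
  rewrite (bigD1 k) /=; last by rewrite Bk.
  by rewrite lerDl; apply: sumr_ge0 => h /andP[/andP[Bh nz_h] _]; apply: c_ge0.
have := le_lt_trans le_c lt4; rewrite /c xm opprB addrCA subrr addr0 -natrM ltr_nat.
case: m xm => [|m] _; first by rewrite !muln0 subr0.
by have := ideg_gt0 k => d_gt0 lt_4; exfalso; move: d_gt0 lt_4; clear; nia.
Qed.

(* chi * chi^* = 1 + a + b and, unless chi is real, chi * chi = c + d with
   c != d; the two products have the same norm, 3 or 5 against 2. *)
Lemma real_irr3_even :
  exists k : Iirr P, [/\ ideg k = 3, M \subset cfker 'chi_k & conjC_Iirr k = k].
Proof.
have [B0 val] := block_value.
have j0 : j = 0%R.
  by apply: (central_block_uniq B0); rewrite block0P cfker_irr0.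
have B0i : i \in block 0%R by rewrite -j0.
rewrite {}j0 in B0 val.
have nz_i : i != 0%R by apply/eqP=> i0; move: di; rewrite i0 ideg0.
have xi := val i B0i nz_i.
have sum_val r : {subset r <= block 0%R} -> 0%R \notin r ->
    ((\sum_(k <- r) 'chi[P]_k) x = (\sum_(k <- r) ideg k)%:R - (4 * size r)%:R)%R.
  elim: r => [|k r IHr] sr r0; first by rewrite !big_nil cfunE subrr.
  rewrite !big_cons cfunE val ?sr ?mem_head //; last first.
    by apply: contraNneq r0 => <-; rewrite mem_head.
  rewrite IHr => [|h rh|]; first by rewrite mulnS !natrD; ring.
    by rewrite sr // inE rh orbT.
  by apply: contra r0; rewrite inE orbC => ->.
have [r r0 def_r] := irr_mul_conj_seq i.
have m1 : (3%:R - 4%:R = -1 :> algC)%R by rewrite -opprB -natrB.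
(* Each constituent of degree d has value d - 4 at x, and chi(x) = -1, so 8 - 4 |r| = 0. For the
   square of chi the same count is 9 - 4 |r2| = 1. *)
have size_r : size r = 2.
  have := sum_val r _ r0; rewrite (mul_conj_ideg def_r) di => sv.
  have /cfunP/(_ x) := def_r; rewrite !cfunE sv => [|k rk]; last first.
    by rewrite block0P; apply: (irr_mul_conj_ker def_r).
  rewrite cfun1E Px xi di m1 rmorphN rmorph1 mulrNN mulr1 => /eqP.
  rewrite eq_sym -subr_eq0 -[true%:R%R]/(1%R : algC) addrC addKr subr_eq0 eqr_nat.
  by rewrite -[X in X == _]/(4 * 2) eqn_pmul2l // => /eqP.
have /char_sum_irr[r2 def_r2] : ('chi_i * 'chi_i)%R \is a character.
  by rewrite rpredM ?irr_char.
have Mker2 k : k \in r2 -> k \in block 0%R.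
  move=> rk; rewrite block0P.
  have Nr : (\sum_(k <- r2) 'chi_k)%R \is a character by apply: rpred_sum => h _; apply: irr_char.
  apply: subset_trans (cfker_constt Nr (mem_irr_seq_constt rk)).
  rewrite -def_r2; apply/subsetP=> z Mz; rewrite cfkerEchar ?rpredM ?irr_char // inE (subsetP sMP) //=.
  have Kz : z \in cfker 'chi_i by move: B0i; rewrite block0P => /subsetP->.
  by rewrite !cfunE cfker1.
have [r20|r20] := boolP (0%R \in r2).
  exists i; split=> //; first by rewrite -block0P.
  have : '['chi_i * 'chi_i, 1]%R != 0%R.
    by rewrite def_r2 -irr0 cfdot_irr_seq pnatr_eq0 -lt0n -has_count has_pred1.
  have -> : ('['chi_i * 'chi_i, 1] = '['chi_i, ('chi_i)^*%CF])%R.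
    rewrite !cfdotE; congr (_ * _)%R; apply: eq_bigr => y Py.
    by rewrite !cfunE cfun1E Py rmorph1 mulr1 conjCK.
  by rewrite -conjC_IirrE cfdot_irr; case: (i =P conjC_Iirr i) => [<-|_ /eqP[]].
have sum_r2 : \sum_(k <- r2) ideg k = 9.
  have /cfunP/(_ 1%g) := def_r2; rewrite !cfunE irr_seq1 irr1E di -natrM => /eqP.
  by rewrite eqr_nat => /eqP.
have size_r2 : size r2 = 2.
  have := sum_val r2 Mker2 r20; rewrite sum_r2 -def_r2 cfunE xi di m1 mulrNN mulr1 => /eqP.
  rewrite eq_sym subr_eq -(natrD _ 1) eqr_nat -[X in X == _]/(1 + 4 * 2) eqn_add2l.
  by rewrite eqn_pmul2l // => /eqP.
have := cfdot_mul_conj i; rewrite def_r def_r2.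
case: r r0 size_r {def_r} => [|a [|b [|]]] //= r0 _.
case: r2 r20 size_r2 sum_r2 {def_r2 Mker2} => [|c [|d [|]]] //= r20 _ sum_r2.
have neq_cd : c != d.
  apply/eqP=> eq_cd; move: sum_r2; rewrite eq_cd !big_cons big_nil addn0 addnn.
  by move/(congr1 odd); rewrite odd_double.
rewrite -irr0 !big_cons !big_nil !addr0 !cfdotDl !cfdotDr !cfdot_irr !eqxx.
rewrite !inE !negb_or in r0; case/andP: r0 => /negPf a0 /negPf b0.
rewrite (eq_sym a) (eq_sym b) a0 b0 (negPf neq_cd) [d == c]eq_sym (negPf neq_cd) [b == a]eq_sym.
by rewrite -!natrD => /eqP; rewrite eqr_nat; case: (a == b).
Qed.

End EvenOrder.

End NoDegree2.

Lemma real_irr3 :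
  exists k : Iirr P, [/\ ideg k = 3, M \subset cfker 'chi_k & conjC_Iirr k = k].
Proof.
have [/existsP[i /eqP/real_irr3_of_deg2//]|/existsPn no2] := boolP [exists i : Iirr P, ideg i == 2].
have [j [i [pos_j Bi di]]] := positive_block_deg3 no2.
have [oddL|evenL] := boolP (odd #|P : M|); first exact: (real_irr3_odd no2 oddL di).
have [x [Px M'x Mx2 x2]] := quo_involution_lift evenL.
exact: (real_irr3_even pos_j Bi di Px M'x Mx2 x2).
Qed.

End RealCharacter.

(** * Finite rotation groups *)

Section Rotations.

Variables (gT : finGroupType) (L : {group gT}) (rG : mx_representation algC L 3).
Hypotheses (perfL : L^`(1)%g = L) (realG : forall x, x \in L -> (cfRepr rG x)^*%R = cfRepr rG x).
Hypothesis ffulG : forall x, x \in L -> cfRepr rG x = 3%:R%R -> x = 1%g.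

(** The eigenvalues a, b, c have modulus 1 and product 1. Since conjugation inverts them, reality of
    the trace gives ab + bc + ca = a + b + c, and the characteristic polynomial is that of a
    rotation. *)
Lemma rotation_eigenvalues x : x \in L -> exists e : 'rV[algC]_3, exists2 B : 'M[algC]_3,
  B \in unitmx & [/\ rG x = (invmx B *m diag_mx e *m B)%R,
    cfRepr rG x = (\sum_k e 0 k)%R,
    (forall k, e 0 k != 0)%R,
    (\prod_k e 0 k = 1)%R &
    forall t : algC, (\prod_k (t - e 0 k) = (t - 1) * (t ^+ 2 + t * (1 - cfRepr rG x) + 1))%R].
Proof.
move=> Lx; have [e [[B uB rx] [_ e1] [chix _] _]] := repr_rsim_diag rG Lx.
have nz_e k : (e 0 k != 0)%R by rewrite -normr_eq0 e1 oner_eq0.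
have pe : (\prod_k e 0 k = 1)%R.
  rewrite -[RHS](perfect_det perfL rG Lx) rx !det_mulmx det_inv mulrC mulrA divrr -?unitmxE //.
  by rewrite mul1r det_diag.
exists e, B => //; split=> // t.
have conje k : ((e 0 k)^* = (e 0 k)^-1)%R.
  by rewrite -[LHS]mul1r -[X in (X * _)%R](mulVf (nz_e k)) -mulrA -normCK e1 expr1n mulr1.
have := realG Lx; rewrite chix rmorph_sum /= (eq_bigr _ (fun k _ => conje k)).
rewrite !big_ord_recl !big_ord0 !addr0 !mulr1 in pe *.
have := nz_e ord0; have := nz_e (lift ord0 ord0); have := nz_e (lift ord0 (lift ord0 ord0)).
move: (e 0%R ord0) (e 0%R (lift ord0 ord0)) (e 0%R (lift ord0 (lift ord0 ord0))) pe => /= a b c pe nzc nzb nza re.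
have s2 : (a * b + b * c + a * c = a + b + c)%R.
  have -> : (a * b + b * c + a * c = (a * (b * c)) * (a^-1 + (b^-1 + c^-1)))%R.
    by field; rewrite nza nzb nzc.
  by rewrite pe mul1r re addrA.
have -> : ((t - a) * ((t - b) * (t - c)) =
    t ^+ 3 - t ^+ 2 * (a + b + c) + t * (a * b + b * c + a * c) - a * (b * c))%R by ring.
by rewrite s2 pe; ring.
Qed.

Lemma rotation_trace x (u : 'rV[algC]_3) mu : x \in L -> u != 0%R ->
    (u *m rG x = mu *: u)%R -> mu != 1%R ->
  (mu != 0 /\ cfRepr rG x = 1 + mu + mu^-1)%R.
Proof.
move=> Lx nz_u ux mu1; have [e [B uB [rx _ nz_e _ charx]]] := rotation_eigenvalues Lx.
pose w := (u *m invmx B)%R.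
have nz_w : w != 0%R.
  by apply: contraNneq nz_u => w0; rewrite -[u](mulmxKV uB) -/w w0 mul0mx.
have [k wk] : exists k, w 0%R k != 0%R.
  by apply/rV0Pn.
have wd : (w *m diag_mx e = mu *: w)%R.
  rewrite /w scalemxAl -ux rx !mulmxA mulmxK //.
have ek : mu = (e 0 k)%R.
  move/matrixP: wd => /(_ 0%R k); rewrite mul_mx_diag mxE [RHS]mxE mulrC.
  by move/(mulIf wk).
have mu0 : mu != 0%R by rewrite ek.
split=> //; have := charx mu; rewrite (bigD1 k) //= -ek subrr mul0r => /esym/eqP.
rewrite mulf_eq0 subr_eq0 (negPf mu1) /= => /eqP char0.
apply: (mulfI mu0); rewrite -[LHS]subr0 -[X in (_ - X)%R]oppr0 -char0.
by field.
Qed.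

Definition axis x := kermx (rG x - 1%:M)%R.

Lemma axisP x m (w : 'M[algC]_(m, 3)) : reflect (w *m rG x = w)%R (w <= axis x)%MS.
Proof.
apply: (iffP sub_kermxP); rewrite mulmxBr mulmx1; last by move=> ->; rewrite subrr.
by move/eqP; rewrite subr_eq0 => /eqP.
Qed.

(** The eigenvalue 1 occurs; if it occurred twice, the product 1 would force it three times, and the
    trace 3 would give x = 1. *)
Lemma axis_rank1 x : x \in L -> x != 1%g -> \rank (axis x) = 1.
Proof.
move=> Lx ntx; have [e [B uB [rx chix nz_e pe charx]]] := rotation_eigenvalues Lx.
have [k ek] : exists k, (e 0 k = 1)%R.
  have := charx 1%R; rewrite subrr mul0r => /eqP; rewrite prodf_seq_eq0 => /hasP[k _].
  by rewrite /= subr_eq0 => /eqP; exists k.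
have uniq_k k' : (e 0 k' = 1)%R -> k' = k.
  move=> ek'; apply: contraNeq ntx => nekk'; apply/eqP/ffulG => //.
  have e1 h : (e 0 h = 1)%R.
    have [->//|nehk] := eqVneq h k; have [->//|nehk'] := eqVneq h k'.
    move: pe; rewrite (bigD1 k) //= (bigD1 k') //= (bigD1 h) /=; last by rewrite nehk.
    rewrite ek ek' !mul1r big1 ?mulr1 // => g /andP[/andP[gk gk'] gh].
    by move: gk gk' gh nehk nehk' nekk'; clear; case: g h k k' => [[|[|[|//]]] g] [[|[|[|//]]] h] [[|[|[|//]]] k] [[|[|[|//]]] k'].
  by rewrite chix (eq_bigr _ (fun h _ => e1 h)) sumr_const card_ord.
pose v := (delta_mx 0 k *m B : 'rV[algC]_3)%R.
have defF : (axis x :=: v)%MS.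
  apply/eqmxP/andP; split.
    apply/row_subP => r; set u := row r _.
    have /axisP ux : (u <= axis x)%MS by apply: row_sub.
    pose w := (u *m invmx B)%R.
    have wd : (w *m diag_mx e = w)%R by rewrite /w -[in RHS]ux rx !mulmxA mulmxK.
    have -> : u = (w 0 k *: v)%R.
      rewrite -[u](mulmxKV uB) -/w /v scalemxAl; congr (_ *m _)%R.
      apply/rowP=> h; rewrite [RHS]mxE [X in (_ * X)%R]mxE eqxx /=; have [->|nehk] := eqVneq h k; first by rewrite mulr1.
      rewrite mulr0; move/matrixP: wd => /(_ 0%R h); rewrite mul_mx_diag mxE => /eqP.
      rewrite -subr_eq0 -[X in (_ - X)%R]mulr1 -mulrBr mulf_eq0 subr_eq0 => /orP[/eqP//|/eqP/uniq_k].
      by move=> eqhk; rewrite eqhk eqxx in nehk.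
    exact: scalemx_sub.
  apply/axisP; rewrite rx /v !mulmxA mulmxK //; congr (_ *m _)%R.
  apply/rowP=> h; rewrite mul_mx_diag !mxE eqxx /=.
  by have [->|nehk] := eqVneq h k; rewrite ?mul0r // ek mulr1.
rewrite defF /v mxrankMfree ?row_free_unit // mxrank_delta //.
Qed.

(** The pointwise stabiliser, that is the rotations about the axis; half-turns reversing it are
    excluded. *)
Definition axis_stab x := rstab rG (axis x).

Lemma axis_stab_id x : x \in L -> x \in axis_stab x.
Proof. by move=> Lx; rewrite inE Lx; apply/eqP/axisP. Qed.

Lemma axis_stab_sub x : axis_stab x \subset L.
Proof. exact: rstab_sub. Qed.

Lemma axis_stabS x y : x \in L -> x != 1%g -> y \in axis_stab x -> y != 1%g ->
  (axis y :=: axis x)%MS.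
Proof.
move=> Lx ntx; rewrite inE => /andP[Ly /eqP/axisP sxy] nty; apply/eqmx_sym/eqmxP.
by rewrite -mxrank_leqif_eq // !axis_rank1.
Qed.

Lemma axisJ x n : x \in L -> n \in L -> (axis (x ^ n)%g :=: axis x *m rG n)%MS.
Proof.
move=> Lx Ln; apply/eqmxP/andP; split; last first.
  apply/axisP; rewrite -mulmxA -repr_mxM ?groupJ // -conjgC repr_mxM // mulmxA.
  by congr (_ *m _)%R; apply/axisP.
rewrite -[axis (x ^ n)%g](repr_mxKV rG Ln); rewrite submxMr //.
apply/axisP; have /axisP ax := submx_refl (axis (x ^ n)%g).
rewrite -mulmxA -repr_mxM ?groupV //.
have -> : (n^-1 * x = x ^ n * n^-1)%g by rewrite conjgE !mulgA mulgK.
by rewrite repr_mxM ?groupV ?groupJ // mulmxA ax.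
Qed.

Lemma axis_stabJ x n : x \in L -> n \in L -> axis_stab (x ^ n)%g = (axis_stab x :^ n)%g.
Proof.
move=> Lx Ln; rewrite /axis_stab (eqmx_rstab _ (axisJ Lx Ln)); apply/setP=> y.
rewrite mem_conjg !inE groupJr ?groupV //; apply: andb_id2l => Ly.
have -> : (axis x *m rG n *m rG y = axis x *m rG (y ^ n^-1)%g *m rG n)%R.
  rewrite -!mulmxA -!repr_mxM ?groupJ ?groupV //.
  by rewrite conjgE invgK !mulgA mulgKV.
by rewrite (can_eq (repr_mxK rG Ln)).
Qed.

(* An element n normalising the stabiliser A acts on the axis by a scalar lam.
   If lam != 1, all of n A has trace 1 + lam + lam^-1, whereas the sum of A is
   #|A| times a projection onto the axis, so the traces add up to #|A| lam. *)
Lemma axis_stab_norm x : x \in L -> x != 1%g ->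
  forall n, n \in 'N_L(axis_stab x) -> n \notin axis_stab x -> (axis x *m rG n = - axis x)%R.
Proof.
move=> Lx ntx n /setIP[Ln nAn] A'n.
have xnA : (x ^ n)%g \in axis_stab x by rewrite memJ_norm // axis_stab_id.
have eqax : (axis x *m rG n :=: axis x)%MS.
  apply: eqmx_trans (eqmx_sym (axisJ Lx Ln)) _.
  by apply: axis_stabS => //; rewrite ?groupJ // conjg_eq1.
have rk1 := axis_rank1 Lx ntx.
pose v := nz_row (axis x).
have nz_v : v != 0%R by rewrite nz_row_eq0 -mxrank_eq0 rk1.
have defv : (v :=: axis x)%MS.
  apply/eqmxP; rewrite -mxrank_leqif_eq ?nz_row_sub // rk1 eqn_leq.
  by rewrite rank_leq_row lt0n mxrank_eq0.
have [lam vn] : exists lam, (v *m rG n = lam *: v)%R.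
  by apply/sub_rVP; rewrite defv -eqax submxMr // nz_row_sub.
have [w defax] : exists w, (axis x = w *m v)%R by apply/submxP; rewrite defv.
have lam1 : lam != 1%R.
  apply: contraNneq A'n => l1; rewrite inE Ln defax -mulmxA vn l1 scale1r; exact: eqxx.
suff lamN1 : lam = (-1)%R by rewrite defax -mulmxA vn -scalemxAr lamN1 scaleN1r.
pose A := axis_stab x; pose E := (\sum_(a in A) rG a)%R.
have sAL : A \subset L := axis_stab_sub x.
have va a : a \in A -> (v *m rG a = v)%R.
  rewrite inE => /andP[_ /eqP fa]; have /submxP[u ->] : (v <= axis x)%MS by rewrite defv.
  by rewrite -mulmxA fa.
have chi_na a : a \in A -> lam != 0%R /\ (cfRepr rG (n * a)%g = 1 + lam + lam^-1)%R.
  move=> Aa; have La := subsetP sAL a Aa; apply: (rotation_trace _ nz_v) => //.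
    by rewrite groupM.
  by rewrite repr_mxM // mulmxA vn -scalemxAl va.
have [lam0 _] := chi_na 1%g (group1 (rstab_group rG (axis x))).
have nzA : (#|A|%:R != 0 :> algC)%R by rewrite pnatr_eq0 -lt0n (cardG_gt0 (rstab_group rG (axis x))).
have trnE : (\tr (rG n *m E) = #|A|%:R * (1 + lam + lam^-1))%R.
  rewrite mulmx_sumr raddf_sum /= -mulr_natl mulr1 -mulr_natl mulr1.
  rewrite mulr_natl -sumr_const; apply: eq_bigr => a Aa.
  have [_ <-] := chi_na a Aa; have La := subsetP sAL a Aa.
  by rewrite cfunE groupM // repr_mxM.
have Ex : (E *m rG x = E)%R.
  have Ax : x \in A by apply: axis_stab_id.
  rewrite mulmx_suml [RHS](reindex_inj (mulIg x)) /=.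
  apply: eq_big => [a|a Aa]; first by rewrite (groupMr _ (Ax : x \in rstab_group rG (axis x))).
  by rewrite repr_mxM // (subsetP sAL).
have /submxP[u defE] : (E <= v)%MS by rewrite defv; apply/axisP.
have vu : (v *m u = #|A|%:R%:M)%R.
  have vE : (v *m E = #|A|%:R *: v)%R.
    rewrite mulmx_sumr (eq_bigr (fun=> v)); last by move=> a; apply: va.
    by rewrite sumr_const scaler_nat.
  have := vE; rewrite defE mulmxA [(v *m u)%R]mx11_scalar mul_scalar_mx => /eqP.
  rewrite -subr_eq0 -scalerBl scaler_eq0 (negPf nz_v) orbF subr_eq0 => /eqP->.
  by [].
have := trnE; rewrite defE mulmxA mxtrace_mulC mulmxA vn -scalemxAl vu.
rewrite linearZ /= mxtrace_scalar mulr1n mulrC => /(mulfI nzA) eq_lam.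
have : (1 + lam^-1 = 0)%R by apply: (addrI lam); rewrite addr0 [RHS]eq_lam; ring.
by move/eqP; rewrite addrC addr_eq0 => /eqP eqV; rewrite -[lam]invrK eqV invrN invr1.
Qed.

End Rotations.

(** * Klein's equation for the poles *)

Section PoleArithmetic.

Variable n : nat.

(* a is the order of the stabiliser A of an axis and q the index of 'N_L(A) in
   the group L of order n, so that (a - 1) * q nontrivial elements of L fix one
   of the conjugates of that axis. *)
Definition pole_orbit (b : nat) : Prop :=
  exists a q, [/\ 2 <= a, 2 <= q, b = (a - 1) * q & n = q * a \/ n = 2 * (q * a)].

(** The equation is 1/a1 + 1/a2 + 1/a3 = 1 + 2/n. With a1 = 2 and a2 <= a3 it leaves (2,3,3),
    (2,3,4) and (2,3,5); the dihedral solution (2,2,m) has q3 = 1. *)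
Lemma pole_orbits3 q1 a1 q2 a2 q3 a3 :
    2 <= a2 -> 2 <= a3 -> 2 <= q1 -> 2 <= q2 -> 2 <= q3 -> a1 = 2 ->
    n = 2 * (q1 * a1) -> n = 2 * (q2 * a2) -> n = 2 * (q3 * a3) ->
    2 * (q1 + q2 + q3) = n + 2 ->
  [\/ n = 12, n = 24 | n = 60].
Proof.
move=> a2_ge a3_ge q1_ge q2_ge q3_ge -> E1 E2 E3 S.
have S' : q2 + q3 = q1 + 1 by lia.
have F2 : q2 * a2 = 2 * q1 by lia.
have F3 : q3 * a3 = 2 * q1 by lia.
have {E2 E3 S} -> : n = 4 * q1 by lia.
wlog le23 : a2 a3 q2 q3 a2_ge a3_ge q2_ge q3_ge S' F2 F3 / a2 <= a3.
  move=> IH; have [le23|lt32] := leqP a2 a3; first exact: (IH a2 a3 q2 q3).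
  by apply: (IH a3 a2 q3 q2) => //; [rewrite addnC | apply: ltnW].
have [lt4|ge4] := ltnP a2 4; last first.
  have : q2 * 4 <= q2 * a2 by rewrite leq_mul2l ge4 orbT.
  have : q3 * 4 <= q3 * a3 by rewrite leq_mul2l (leq_trans ge4 le23) orbT.
  lia.
have [a22|a23] : a2 = 2 \/ a2 = 3 by lia.
  by rewrite a22 in F2; lia.
rewrite a23 in F2 le23.
have [lt6|ge6] := ltnP a3 6; last first.
  have : q3 * 6 <= q3 * a3 by rewrite leq_mul2l ge6 orbT.
  lia.
have : [\/ a3 = 3, a3 = 4 | a3 = 5].
  by case: a3 le23 lt6 {a3_ge F3} => [|[|[|[|[|[|]]]]]] // _ _; [apply: Or31|apply: Or32|apply: Or33].
case=> a3E; rewrite a3E in F3; [apply: Or31 | apply: Or32 | apply: Or33]; lia.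
Qed.

(** Here 2/a1 + 1/a2 = 1 + 2/n, solved by the tetrahedral a1 = 3, a2 = 2; a1 = 2 would force q2 =
    1. *)
Lemma pole_orbits2 q1 a1 q2 a2 :
    2 <= a1 -> 2 <= a2 -> 2 <= q1 -> 2 <= q2 -> n = q1 * a1 -> n = 2 * (q2 * a2) ->
    2 * (q1 + q2) = n + 2 -> n = 12.
Proof.
move=> a1_ge a2_ge q1_ge q2_ge E1 E2 S.
have [lt4|ge4] := ltnP a1 4; last first.
  have : q1 * 4 <= q1 * a1 by rewrite leq_mul2l ge4 orbT.
  have : q2 * 2 <= q2 * a2 by rewrite leq_mul2l a2_ge orbT.
  lia.
have [a12|a13] : a1 = 2 \/ a1 = 3 by lia.
  by rewrite a12 in E1; lia.
rewrite a13 in E1; have [lt3|ge3] := ltnP a2 3; last first.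
  have : q2 * 3 <= q2 * a2 by rewrite leq_mul2l ge3 orbT.
  lia.
have a22 : a2 = 2 by lia.
by rewrite a22 in E2; lia.
Qed.

(** From a >= 2, (a - 1) q is at least aq/2, hence at least n/4. The total being n - 1, there are at
    most three orbits, and of the orders 12, 24, 60 only the last survives. *)
Lemma pole_orbits_order s :
  17 <= n -> n != 24 -> (forall b, b \in s -> pole_orbit b) -> sumn s = n - 1 -> n = 60.
Proof.
move=> n17 n24 Qs sum_s.
have Q b : b \in s -> exists q a, [/\ 2 <= a, 2 <= q, b + q = q * a, 2 * q <= q * a & n = q * a \/ n = 2 * (q * a)].
  move=> /Qs[a [q [a2 q2 -> defn]]]; exists q, a; split=> //.
    by rewrite mulnBl mul1n subnK ?leq_pmull 1?mulnC // ltnW.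
  by rewrite mulnC leq_mul2l a2 orbT.
case: s => [|b1 [|b2 [|b3 [|b4 s]]]] /= in sum_s Q {Qs}; first by clear Q; lia.
- have [q1 [a1 [A1 Q1 D1 L1 N1]]] := Q b1 (mem_head _ _).
  by move: (q1 * a1) D1 L1 N1 => X1; clear Q; lia.
- have [q1 [a1 [A1 Q1 D1 L1 N1]]] : exists q a, _ := Q b1 (mem_head _ _).
  have [|q2 [a2 [A2 Q2 D2 L2 N2]]] := Q b2; first by rewrite !inE eqxx orbT.
  clear Q; suff : n = 12 by lia.
  case: N1 N2 => N1 [N2|N2].
  + by move: (q1 * a1) (q2 * a2) D1 L1 N1 D2 L2 N2 => X1 X2; lia.
  + apply: (@pole_orbits2 q1 a1 q2 a2) => //.
    by move: (q1 * a1) (q2 * a2) D1 L1 N1 D2 L2 N2 => X1 X2; lia.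
  + apply: (@pole_orbits2 q2 a2 q1 a1) => //.
    by move: (q1 * a1) (q2 * a2) D1 L1 N1 D2 L2 N2 => X1 X2; lia.
  by move: (q1 * a1) (q2 * a2) D1 L1 N1 D2 L2 N2 => X1 X2; lia.
- have [q1 [a1 [A1 Q1 D1 L1 N1]]] : exists q a, _ := Q b1 (mem_head _ _).
  have [|q2 [a2 [A2 Q2 D2 L2 N2]]] := Q b2; first by rewrite !inE eqxx orbT.
  have [|q3 [a3 [A3 Q3 D3 L3 N3]]] := Q b3; first by rewrite !inE eqxx !orbT.
  clear Q; have [E1 E2 E3 S] : [/\ n = 2 * (q1 * a1), n = 2 * (q2 * a2), n = 2 * (q3 * a3) & 2 * (q1 + q2 + q3) = n + 2].
    move: (q1 * a1) (q2 * a2) (q3 * a3) D1 L1 N1 D2 L2 N2 D3 L3 N3 => X1 X2 X3.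
    by move=> D1 L1 N1 D2 L2 N2 D3 L3 N3; split; lia.
  suff : [\/ n = 12, n = 24 | n = 60] by case=> // En; move: n17 n24; rewrite En.
  have ge3 q a : 2 <= a -> a != 2 -> 3 * q <= q * a.
    by move=> age an2; rewrite mulnC leq_mul2l ltn_neqAle [2 == a]eq_sym an2 age orbT.
  have [a12|a1n2] := eqVneq a1 2; first exact: (@pole_orbits3 q1 a1 q2 a2 q3 a3).
  have [a22|a2n2] := eqVneq a2 2.
    by apply: (@pole_orbits3 q2 a2 q1 a1 q3 a3) => //; rewrite (addnC q2).
  have [a32|a3n2] := eqVneq a3 2.
    by apply: (@pole_orbits3 q3 a3 q1 a1 q2 a2) => //; rewrite -addnA addnC.
  have := ge3 q1 a1 A1 a1n2; have := ge3 q2 a2 A2 a2n2; have := ge3 q3 a3 A3 a3n2.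
  clear D1 D2 D3 L1 L2 L3 N1 N2 N3 ge3.
  by move: (q1 * a1) (q2 * a2) (q3 * a3) E1 E2 E3 => X1 X2 X3; lia.
have Q4 b : b \in [:: b1, b2, b3, b4 & s] -> n <= 4 * b.
  case/Q=> q [a [_ _ D L N]].
  by move: (q * a) D L N => X; clear; lia.
clear Q; have := Q4 b1; have := Q4 b2; have := Q4 b3; have := Q4 b4.
rewrite !inE !eqxx !orbT /= => /(_ isT) h4 /(_ isT) h3 /(_ isT) h2 /(_ isT) h1.
by clear Q4; lia.
Qed.

End PoleArithmetic.

(** * Sorting rotations by their axes *)

Section AxisCount.

Variables (gT : finGroupType) (L : {group gT}) (rG : mx_representation algC L 3).
Hypotheses (simL : simple L) (nabL : ~~ abelian L) (irrG : mx_irreducible rG).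
Hypothesis realG : forall x, x \in L -> (cfRepr rG x)^*%R = cfRepr rG x.
Hypothesis ffulG : forall x, x \in L -> cfRepr rG x = 3%:R%R -> x = 1%g.

Let perfL : L^`(1)%g = L := simple_perfect simL nabL.
Let stab x : {group gT} := rstab_group rG (axis rG x).

Lemma stab_id x : x \in L -> x \in stab x.
Proof. exact: axis_stab_id. Qed.

Lemma stab_sub x : stab x \subset L.
Proof. exact: rstab_sub. Qed.

Lemma stab_eq x y : x \in L^# -> y \in (stab x)^# -> stab y = stab x.
Proof.
move=> /setD1P[ntx Lx] /setD1P[nty sxy]; apply/group_inj.
exact: eqmx_rstab (axis_stabS perfL realG ffulG Lx ntx sxy nty).
Qed.

Lemma stabJ x n : x \in L -> n \in L -> stab (x ^ n)%g = (stab x :^ n)%G.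
Proof. by move=> Lx Ln; apply/group_inj; apply: axis_stabJ. Qed.

(** Elements of the normaliser outside the stabiliser negate the axis, so the product of any two of
    them fixes it. *)
Lemma stab_norm_card x : x \in L^# ->
  #|'N_L(stab x)| = #|stab x| \/ #|'N_L(stab x)| = 2 * #|stab x|.
Proof.
move=> /setD1P[ntx Lx]; have sAN : stab x \subset 'N_L(stab x) by rewrite subsetI stab_sub normG.
have [sNA|] := boolP ('N_L(stab x) \subset stab x).
  by left; apply/eqP; rewrite eqn_leq !subset_leq_card.
case/subsetPn=> n Nn A'n; right.
have opp := axis_stab_norm perfL realG ffulG Lx ntx.
have defN : 'N_L(stab x) = stab x :|: (stab x :* n^-1)%g.
  apply/setP=> m; rewrite in_setU mem_rcoset invgK; apply/idP/orP => [Nm|[|]].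
  - have [|A'm] := boolP (m \in stab x); first by left.
    right; have [Lm _] := setIP Nm; have [Ln _] := setIP Nn.
    rewrite inE groupM // repr_mxM // mulmxA (opp m Nm A'm) mulNmx (opp n Nn A'n) opprK.
    exact: eqxx.
  - exact: subsetP.
  by move/(subsetP sAN) => Nmn; rewrite -(groupMr _ Nn).
rewrite defN cardsU card_rcoset disjoint_setI0 ?cards0 ?subn0 ?mul2n ?addnn //.
rewrite -setI_eq0; apply/eqP/setP=> m; rewrite in_setI mem_rcoset invgK in_set0.
by apply/andP=> -[Am]; rewrite groupMl // (negPf A'n).
Qed.

(** A normal stabiliser would be all of L by simplicity, making the axis an invariant line of an
    irreducible representation of degree 3. *)
Lemma stab_norm_proper x : x \in L^# -> 2 <= #|L : 'N_L(stab x)|.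
Proof.
move=> L1x; have [ntx Lx] := setD1P L1x.
rewrite indexg_gt1; apply/negP=> sLN.
have nsA : stab x <| L by rewrite /normal stab_sub (subset_trans sLN) ?subsetIr.
have [_ /(_ _ nsA)[A1|AL]] := simpleP _ simL.
  by case/negP: ntx; apply/eqP/set1gP; rewrite -A1 stab_id.
have [_ /(_ (axis rG x))] := (mx_irrP rG).1 irrG.
rewrite /row_full -mxrank_eq0 (axis_rank1 perfL realG ffulG Lx ntx) => /(_ _ isT) full.
suff /full : mxmodule rG (axis rG x) by [].
apply/mxmoduleP=> y Ly; have : y \in stab x by rewrite AL.
by rewrite inE => /andP[_ /eqP->].
Qed.

Let supp x := class_support (stab x)^# L.

(** Two stabilisers sharing a nontrivial rotation have the same axis, so they coincide. *)
Lemma supp_TI x : x \in L^# -> normedTI (stab x)^# L 'N_L(stab x).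
Proof.
move=> L1x; have [ntx Lx] := setD1P L1x; apply/and3P; split.
- by apply/set0Pn; exists x; rewrite 2!inE ntx stab_id.
- apply/trivIsetP=> _ _ /imsetP[a La ->] /imsetP[b Lb ->]; apply: contraR.
  rewrite -setI_eq0 => /set0Pn[y /setIP[]]; rewrite !mem_conjg => Aa Ab.
  have stabE c : c \in L -> (y ^ c^-1)%g \in (stab x)^# -> (stab x)^# :^ c = (stab y)^#.
    move=> Lc yc; rewrite conjD1g; congr (_^#).
    have Ly : y \in L by have [_ /(subsetP (stab_sub x))] := setD1P yc; rewrite groupJr ?groupV.
    by rewrite -(stab_eq L1x yc) stabJ ?groupV //= conjsgKV.
  by rewrite !stabE.
by rewrite normD1.
Qed.

Lemma supp_eq x y : x \in L^# -> y \in L^# -> (y \in supp x) = (supp x == supp y).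
Proof.
move=> L1x L1y; apply/idP/eqP => [|->]; last first.
  have [nty Ly] := setD1P L1y; apply: (subsetP (sub_class_support L _)).
  by rewrite 2!inE nty stab_id.
case/imset2P=> a n Aa Ln ->; have [nta sxa] := setD1P Aa; have La := subsetP (stab_sub x) _ sxa.
rewrite /supp (stabJ La Ln) (stab_eq L1x Aa).
by rewrite -(class_supportGidl (stab x)^# Ln) conjD1g.
Qed.

(** The sets [supp] partition the nontrivial elements into classes of size (a - 1) q, which is
    Klein's count. Order 24 is excluded by Burnside's theorem on two primes. *)
Lemma order_real3 : #|L| = 60.
Proof.
have [_ ge17] := simple_classes_le simL nabL.
have n24 : #|L| != 24.
  apply/eqP=> L24; have solL : solvable L.
    by apply: Burnside_p_a_q_b; rewrite L24.
  by have := simple_sol_prime solL simL; rewrite L24.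
pose PP := preim_partition supp L^#.
have /card_partition : partition PP L^# := preim_partitionP _ _.
move=> cardP.
apply: (@pole_orbits_order _ [seq #|(B : {set gT})| | B <- enum PP]) => //.
  move=> _ /mapP[B + ->]; rewrite mem_enum => /imsetP[x L1x ->].
  have [ntx Lx] := setD1P L1x.
  have -> : [set y in L^# | supp x == supp y] = supp x.
    apply/setP=> y; rewrite inE; apply/andP/idP => [[L1y /eqP eqs]|sy].
      by rewrite supp_eq // eqs.
    suff L1y : y \in L^# by split=> //; rewrite -supp_eq.
    case/imset2P: sy => a n /setD1P[nta sa] Ln ->.
    have La := subsetP (stab_sub x) _ sa.
    by rewrite 2!inE conjg_eq1 nta groupJ.
  have -> : #|supp x| = (#|stab x| - 1) * #|L : 'N_L(stab x)|.
    by rewrite (card_support_normedTI (supp_TI L1x)) [in RHS](cardsD1 1%g) group1 addKn.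
  exists #|stab x|, #|L : 'N_L(stab x)|; split=> //.
  - by rewrite cardG_gt1; apply/trivgPn; exists x; rewrite ?stab_id.
  - exact: stab_norm_proper.
  have := Lagrange (subsetIl L 'N(stab x)); rewrite mulnC.
  by case: (stab_norm_card L1x) => -> <-; [left | right; rewrite mulnCA].
rewrite sumnE big_map big_enum /= -cardP.
by rewrite (cardsD1 1%g L) group1 addKn.
Qed.

End AxisCount.

Lemma order_real_irr3 (gT : finGroupType) (L : {group gT}) (k : Iirr L) :
  simple L -> ~~ abelian L -> ideg k = 3 -> conjC_Iirr k = k -> #|L| = 60.
Proof.
move=> simL nabL dk realk.
have [rG irrG chik] : exists2 rG : mx_representation algC L 3, mx_irreducible rG & cfRepr rG = 'chi_k.
  rewrite -dk; exists 'Chi_k; [exact: socle_irr | exact: irrRepr].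
apply: (order_real3 simL nabL irrG) => x Lx; rewrite chik.
  by rewrite -{2}realk conjC_IirrE cfunE.
move=> xk; have nz_k : k != 0%R by apply/eqP=> k0; move: dk; rewrite k0 ideg0.
apply/set1gP; rewrite -(simple_fful simL nabL nz_k) cfkerEirr inE xk irr1E dk; exact: eqxx.
Qed.

Lemma maxnormal_index60 (gT : finGroupType) (P M : {group gT}) :
    P^`(1)%g = P -> maxnormal M P P -> #|P| < 4 * \sum_i ideg (i : Iirr P) ->
  #|(P / M)%g| = 60.
Proof.
move=> perfP maxM bigP; have [k [dk Mk realk]] := real_irr3 perfP maxM bigP.
have nsMP := maxnormal_normal maxM; have [sMP nMP] := andP nsMP.
have quoE : 'chi_(quo_Iirr M k) = ('chi_k / M)%CF by apply: quo_IirrE.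
apply: (@order_real_irr3 _ _ (quo_Iirr M k)).
- exact: maxnormal_quo_simple maxM.
- exact: maxnormal_quo_nabelian perfP maxM.
- by apply/eqP; rewrite -(eqr_nat algC) -irr1E quoE cfQuo1 irr1E dk.
apply: irr_inj; rewrite conjC_IirrE quoE; apply/cfun_inP=> _ /morphimP[x Nx Px ->].
rewrite cfunE cfQuoE // -[in RHS]realk conjC_IirrE cfunE; congr (_ _).
Qed.

(** * Simple groups of order 60 *)

Section Order60.

Variables (gT : finGroupType) (L : {group gT}).
Hypotheses (simL : simple L) (nabL : ~~ abelian L) (oL : #|L| = 60).

Lemma ideg60 (i : Iirr L) : i != 0%R -> ideg i \in [:: 3; 4; 5; 6].
Proof.
move=> nz_i; have ge3 := simple_ideg_ge3 simL nabL nz_i.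
have := ideg_dvd i; rewrite oL => dv.
have le60 : ideg i ^ 2 <= 60 - 1.
  have := sum_ideg_sqr L; rewrite (bigD1 (0%R : Iirr L)) //= (bigD1 i) //= ideg0 oL => <-.
  by rewrite addKn leq_addr.
have lt8 : ideg i < 8 by rewrite -(ltn_exp2r _ _ (isT : 0 < 2)) (leq_ltn_trans le60).
by move: (ideg i) ge3 dv lt8; do 8?case=> //.
Qed.

Lemma sum60 (F : Iirr L -> nat) : \sum_i F i =
  F 0%R + (\sum_(i | ideg i == 3) F i + \sum_(i | ideg i == 4) F i +
  \sum_(i | ideg i == 5) F i + \sum_(i | ideg i == 6) F i).
Proof.
rewrite (bigD1 (0%R : Iirr L)) //=; congr (_ + _).
rewrite [LHS]big_mkcond [X in X + _ + _ + _]big_mkcond [X in _ + X + _ + _]big_mkcond.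
rewrite [X in _ + _ + X + _]big_mkcond [X in _ + X]big_mkcond -!big_split /=.
apply: eq_bigr => i _; have [->|nz_i] := eqVneq i 0%R; first by rewrite ideg0.
by have := ideg60 nz_i; rewrite !inE => /or4P[]/eqP->; rewrite /= ?addn0 ?add0n.
Qed.

(** Write chi(x) = d - 4m. Orthogonality of the columns of 1 and x gives a total of 15 for d m,
    while the squares of the degrees total 60. Sorting by degree yields a small integer system, and
    the column of x then gives 60 - 8*15 + 16*4 = 4. *)
Lemma degrees60_involution x : x \in L -> #[x] = 2 ->
  [/\ #|classes L| = 5, \sum_i ideg (i : Iirr L) = 16 & #|'C_L[x]| = 4].
Proof.
move=> Lx ox; have perfL := simple_perfect simL nabL.
have val (i : Iirr L) : exists m, [/\ ('chi_i x = (ideg i)%:R - (4 * m)%:R)%R, 2 * m <= ideg i & i != 0%R -> 0 < m].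
  have kx : (x ^+ 2)%g \in cfker 'chi_i by rewrite -ox expg_order group1.
  have [m xm le_m] := irr_involution perfL Lx kx.
  exists m; split=> // nz_i; rewrite lt0n; apply/eqP=> m0.
  have : x \in cfker 'chi_i by rewrite cfkerEirr inE xm m0 muln0 subr0 irr1E.
  by rewrite (simple_fful simL nabL nz_i) => /set1gP x1; rewrite x1 order1 in ox.
have [m mP] := fin_all_exists val.
have sum_m : 4 * \sum_i ideg i * m i = 60.
  have : cfReg L x = 0%R by rewrite cfRegE -order_eq1 ox.
  rewrite cfReg_sum sum_cfunE.
  have -> : (\sum_i ('chi[L]_i 1%g *: 'chi_i) x = \sum_i ((ideg (i : Iirr L) ^ 2)%:R - (4 * (ideg i * m i))%:R))%R.
    apply: eq_bigr => i _; have [xm _ _] := mP i; rewrite cfunE irr1E xm mulrBr -!natrM.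
    by rewrite mulnCA.
  rewrite sumrB -!natr_sum sum_ideg_sqr oL -big_distrr /= => /eqP.
  by rewrite subr_eq0 eqr_nat => /eqP <-.
have m0 : m 0%R = 0.
  by have [_ le_m _] := mP 0%R; rewrite ideg0 in le_m; move: le_m; case: (m 0%R) => // q; rewrite mulnS.
have c1 : #|classes L| = \sum_(i : Iirr L) 1 by rewrite sum_nat_const card_ord NirrE muln1.
have c2 := sum_ideg_sqr L; rewrite oL in c2.
suff [k5 d16 s4] : [/\ #|classes L| = 5, \sum_i ideg (i : Iirr L) = 16 & \sum_i m i = 4].
  split=> //; have m1 i : i != 0%R -> m i = 1.
    move=> nz_i; have [_ _ /(_ nz_i) m_gt0] := mP i; apply/eqP; rewrite eqn_leq m_gt0 andbT.
    have : \sum_(k | k != 0%R :> Iirr L) 1 = 4.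
      by move: c1; rewrite k5 (bigD1 (0%R : Iirr L)) //= add1n => -[<-].
    move: s4; rewrite (bigD1 (0%R : Iirr L)) //= m0 add0n (bigD1 i) //= => s4.
    rewrite (bigD1 i) //= => e4; rewrite -(leq_add2r (\sum_(k | (k != 0%R) && (k != i)) m k)) s4 -e4.
    rewrite leq_add2l; apply: leq_sum => k /andP[nz_k _]; have [_ _] := mP k; exact.
  apply/eqP; rewrite -(eqr_nat algC); apply/eqP.
  have := second_orthogonality_relation x Lx; rewrite class_refl mulr1n => <-.
  have -> : (\sum_i 'chi[L]_i x * ('chi_i x)^* =
      \sum_i ((ideg i ^ 2)%:R - (8 * (ideg i * m i))%:R + (16 * m i)%:R))%R.
    apply: eq_bigr => i _; have [-> _ _] := mP i; rewrite rmorphB !rmorph_nat.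
    have -> : (16 * m i)%:R%R = (16 * (m i * m i))%:R%R :> algC.
      by have [->|nz_i] := eqVneq i 0%R; rewrite ?m0 ?m1.
    by rewrite !natrM; ring.
  rewrite big_split sumrB /= -!natr_sum c2 -!big_distrr /= s4.
  have -> : \sum_i ideg (i : Iirr L) * m i = 15.
    by apply/eqP; rewrite -(eqn_pmul2l (isT : 0 < 4)) sum_m.
  by rewrite !natrM; ring.
rewrite c1; move: sum_m c2; rewrite !sum60 m0 ideg0.
have sumE d (F : nat -> nat) : \sum_(i : Iirr L | ideg i == d) F (ideg i) = F d * \sum_(i : Iirr L | ideg i == d) 1.
  by rewrite big_distrr /=; apply: eq_bigr => i /eqP->; rewrite muln1.
pose n d := \sum_(i : Iirr L | ideg i == d) 1; pose M d := \sum_(i : Iirr L | ideg i == d) m i.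
have sumM d : d \in [:: 3; 4; 5; 6] ->
    [/\ \sum_(i : Iirr L | ideg i == d) ideg i * m i = d * M d, n d <= M d & 2 * M d <= d * n d].
  move=> dE; split.
    by rewrite big_distrr /=; apply: eq_bigr => i /eqP->.
    apply: leq_sum => i /eqP di; have [_ _] := mP i; apply.
    by apply/eqP=> i0; move: dE; rewrite -di i0 ideg0.
  rewrite !big_distrr /=; apply: leq_sum => i /eqP <-.
  by have [_ + _] := mP i; rewrite muln1.
rewrite !(sumE _ (fun d => d ^ 2)) !(sumE _ id).
have [-> + +] := sumM 3 isT; have [-> + +] := sumM 4 isT.
have [-> + +] := sumM 5 isT; have [-> + +] := sumM 6 isT.
rewrite -/(n 3) -/(n 4) -/(n 5) -/(n 6) -/(M 3) -/(M 4) -/(M 5) -/(M 6).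
move: (n 3) (n 4) (n 5) (n 6) (M 3) (M 4) (M 5) (M 6).
(* The only solution has degrees 3, 3, 4, 5 besides 1, and total m equal to 4. *)
clear; move=> n3 n4 n5 n6 M3 M4 M5 M6; split; lia.
Qed.

Lemma degrees60 : #|classes L| = 5 /\ \sum_i ideg (i : Iirr L) = 16.
Proof.
have d2 : 2 %| #|L| by rewrite oL.
by have [x Lx ox] := Cauchy (isT : prime 2) d2; have [] := degrees60_involution Lx ox.
Qed.

End Order60.

Local Open Scope group_scope.
Local Open Scope nat_scope.

Lemma acts_perm_ord (aT : finGroupType) (rT : finType) (G : {group aT})
    (to : {action aT &-> rT}) (X : {set rT}) n :
  #|X| = n -> [acts G, on X | to] ->
  exists f : {morphism G >-> {perm 'I_n}}, 'ker f = 'C_G(X | to).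
Proof.
move=> <-{n} actsG; have toX g x : g \in G -> x \in X -> to x g \in X.
  by move=> Gg Xx; rewrite (acts_act actsG).
pose pf g (i : 'I_#|X|) := enum_rank_in (enum_valP i) (to (enum_val i) g).
have pfE g i : g \in G -> enum_val (pf g i) = to (enum_val i) g.
  by move=> Gg; rewrite enum_rankK_in // toX // enum_valP.
have inj_pf g : g \in G -> injective (pf g).
  by move=> Gg i j /(congr1 enum_val); rewrite !pfE // => /act_inj/enum_val_inj.
(* Injectivity is known only for g in G, whence the dependent match; the value 1 off G is a
   default. *)
pose p g : {perm 'I_#|X|} :=
  match @idP (g \in G) with ReflectT Gg => perm (@inj_pf g Gg) | ReflectF _ => 1%g end.
have pE g i : g \in G -> enum_val (p g i) = to (enum_val i) g.
  by move=> Gg; rewrite /p; case: {-}_ / idP => // Gg'; rewrite permE pfE.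
have pM : {in G &, {morph p : g h / (g * h)%g}}.
  move=> g h Gg Gh; apply/permP=> i; apply: enum_val_inj.
  by rewrite permM !pE ?groupM // actM.
exists (Morphism pM); apply/setP=> g; rewrite !inE; apply: andb_id2l => Gg /=.
apply/eqP/subsetP=> [p1 x Xx | fixX].
  rewrite inE; apply/eqP.
  by rewrite -(enum_rankK_in Xx Xx) -pE // p1 perm1.
apply/permP=> i; apply: enum_val_inj; rewrite pE // perm1.
by have := fixX _ (enum_valP i); rewrite inE => /eqP.
Qed.

Section Sylow60.

Variables (gT : finGroupType) (L : {group gT}).
Hypotheses (simL : simple L) (nabL : ~~ abelian L) (oL : #|L| = 60).

Lemma simple_acts_trivial (rT : finType) (to : {action gT &-> rT}) (X : {set rT}) :
  [acts L, on X | to] -> ~~ (60 %| #|X|`!) -> L \subset 'C(X | to).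
Proof.
move=> actsL n60; have [f kerf] := acts_perm_ord (erefl _) actsL.
have [_ /(_ _ (ker_normal f))[ker1|kerL]] := simpleP _ simL; last first.
  by move: kerL; rewrite /= kerf => /setIidPl.
case/negP: n60; have injf : 'injm f by rewrite ker1.
rewrite -oL -(card_injm injf) //; apply: dvdn_trans (cardSg (subsetT (f @* L))) _.
by rewrite cardsT card_Sn.
Qed.

(** If N_L(S) = S, every nontrivial element of S has centraliser S, so an element conjugating two of
    them normalises S, lies in the abelian group S, and they are equal. The four elements of S, with
    one of order 3 and one of order 5, then give six classes instead of five. *)
Lemma Syl2_60_not_self (S : {group gT}) : 2.-Sylow(L) S -> ~~ ('N_L(S) \subset S).
Proof.
move=> sylS; apply/negP=> sNS; have [sSL pS _] := and3P sylS.
have oS : #|S| = 4 by rewrite (card_Hall sylS) oL p_part.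
have abS : abelian S by apply: (@card_p2group_abelian _ 2) => //; rewrite oS.
have cent_S s : s \in S -> s != 1%g -> 'C_L[s] = S.
  have inv t : t \in S -> #[t] = 2 -> 'C_L[t] = S.
    move=> St ot; have [_ _ cC] := degrees60_involution simL nabL oL (subsetP sSL t St) ot.
    apply/esym/eqP; rewrite eqEcard cC oS leqnn andbT subsetI sSL /=.
    by rewrite sub_cent1 (subsetP abS).
  move=> Ss nts; have : #[s] %| 4 by rewrite -oS order_dvdG.
  have [os|os] := eqVneq #[s] 2; first by rewrite inv.
  move=> dvs; have os4 : #[s] = 4.
    have : 1 < #[s] by rewrite order_gt1.
    have := dvdn_leq (isT : 0 < 4) dvs; move: dvs os.
    by case: #[s] => [|[|[|[|[|]]]]].
  have os2 : #[(s ^+ 2)%g] = 2 by rewrite orderXdiv os4.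
  apply/eqP; rewrite eqEsubset subsetI sSL sub_cent1 (subsetP abS) // andbT.
  have : 'C_L[s] \subset 'C_L[(s ^+ 2)%g] by rewrite setIS // -!cent_cycle centS // cycleX.
  by rewrite (inv _ (groupX 2 Ss) os2) => ->.
have nSS : 'N_L(S) = S by apply/eqP; rewrite eqEsubset sNS subsetI sSL normG.
have d3 : 3 %| #|L| by rewrite oL.
have d5 : 5 %| #|L| by rewrite oL.
have [y3 Ly3 o3] := Cauchy (isT : prime 3) d3.
have [y5 Ly5 o5] := Cauchy (isT : prime 5) d5.
have not_conj x y : #[x] != #[y] -> x ^: L != y ^: L.
  apply: contra_neq => eq_xy; have : x \in y ^: L by rewrite -eq_xy class_refl.
  by case/imsetP=> g _ ->; rewrite orderJ.
have ordS s : s \in S -> (#[s] != 3) && (#[s] != 5).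
  move=> Ss; have := order_dvdG Ss; rewrite oS.
  by case: eqP => [->|_] //; case: eqP => [->|_].
have S3 : y3 \notin S by apply/negP=> /ordS; rewrite o3.
have S5 : y5 \notin S by apply/negP=> /ordS; rewrite o5.
pose X := y3 |: (y5 |: S).
have oX : #|X| = 6.
  have ne35 : y3 != y5 by apply/eqP=> e; move: o3; rewrite e o5.
  by rewrite !cardsU1 !inE (negPf ne35) S5 (negPf S3) oS.
have injX : {in X &, injective (fun x => x ^: L)}.
  have injS : {in S &, injective (fun x => x ^: L)}.
    move=> s t Ss St eq_st; have [s1|nts] := eqVneq s 1%g.
      have : t \in s ^: L by rewrite eq_st class_refl.
      by rewrite s1 class1G => /set1gP.
    have /imsetP[g Lg def_t] : t \in s ^: L by rewrite eq_st class_refl.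
    have ntt : t != 1%g by rewrite def_t conjg_eq1.
    have nSg : g \in S.
      rewrite -nSS inE Lg -[X in _ \in 'N(X)](cent_S s) //; apply/normP.
      by rewrite conjIg conjGid // -cent1J -def_t !cent_S.
    by rewrite def_t conjgE (centsP abS _ Ss _ nSg) mulKg.
  have ne s : s \in S -> (s ^: L != y3 ^: L) && (s ^: L != y5 ^: L).
    by move=> /ordS/andP[n3 n5]; rewrite !not_conj ?o3 ?o5.
  have ne35 : y3 ^: L != y5 ^: L by rewrite not_conj ?o3 ?o5.
  move=> u w /setU1P[->|/setU1P[->|Su]] /setU1P[->|/setU1P[->|Sw]] //= e.
  - by rewrite e eqxx in ne35.
  - by have /andP[] := ne w Sw; rewrite e eqxx.
  - by rewrite e eqxx in ne35.
  - by have /andP[_] := ne w Sw; rewrite e eqxx.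
  - by have /andP[] := ne u Su; rewrite e eqxx.
  - by have /andP[_] := ne u Su; rewrite e eqxx.
  exact: injS.
have [k5 _] := degrees60 simL nabL oL.
have : #|[set x ^: L | x in X]| <= #|classes L|.
  apply: subset_leq_card; apply/subsetP=> _ /imsetP[x Xx ->]; apply: mem_classes.
  by case/setU1P: Xx => [->|/setU1P[->|/(subsetP sSL)]].
by rewrite (card_in_imset injX) oX k5.
Qed.

(** The number divides 15. Neither 1 nor 3 works, as 60 does not divide 3! and the action would be
    trivial; 15 would make S self-normalising. *)
Lemma card_Syl2_60 : #|'Syl_2(L)| = 5.
Proof.
have [S sylS] := Sylow_exists 2 L; have [sSL pS _] := and3P sylS.
have oS : #|S| = 4 by rewrite (card_Hall sylS) oL p_part.
have sSN : S \subset 'N_L(S) by rewrite subsetI sSL normG.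
have nSyl := card_Syl sylS.
have dv : #|'Syl_2(L)| %| 15.
  rewrite -(@dvdn_pmul2l 4) // nSyl -{1}oS -[4 * 15]oL -(Lagrange sSL) dvdn_pmul2l ?cardG_gt0 //.
  by rewrite indexgS.
have ntriv : ~~ (L \subset 'N(S)).
  apply/negP=> nSL; have [_ /(_ S)] := simpleP _ simL.
  rewrite /normal sSL nSL => /(_ isT)[S1|SL].
    by move: oS; rewrite S1 cards1.
  by move: oS; rewrite SL oL.
have actsS : [acts L, on 'Syl_2(L) | 'JG].
  by apply: atrans_acts; first exact: Syl_trans; apply: subsetT.
have fix_SylN : L \subset 'C('Syl_2(L) | 'JG) -> False.
  move=> sLC; case/negP: ntriv; apply/subsetP=> g Lg.
  have /astabP/(_ S) := subsetP sLC g Lg; rewrite inE => /(_ sylS).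
  by move/(congr1 (@gval gT)) => /= defS; apply/normP.
have n60 : 60 %| #|'Syl_2(L)|`!.
  by apply/negPn/negP=> /(simple_acts_trivial actsS)/fix_SylN.
have ne15 : #|'Syl_2(L)| != 15.
  apply: contra (Syl2_60_not_self sylS) => /eqP oN.
  suff -> : 'N_L(S) = S :> {set _} by [].
  apply/esym/eqP; rewrite eqEcard sSN oS -(leq_pmul2r (isT : 0 < 15)) -{1}oN nSyl.
  by rewrite Lagrange ?subsetIl // oL.
have : #|'Syl_2(L)| \in [:: 1; 3; 5; 15] by rewrite -[_ :: _]/(divisors 15) -dvdn_divisors.
rewrite !inE (negPf ne15) orbF => /or3P[] /eqP // oSyl; by rewrite oSyl in n60.
Qed.

End Sylow60.

Lemma card_Alt5 : #|'Alt_('I_5)| = 60.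
Proof. by apply/eqP; rewrite -(eqn_pmul2l (isT : 0 < 2)) card_Alt card_ord. Qed.

Lemma perfect_sub_Alt (T : finType) (A : {group {perm T}}) : A^`(1)%g = A -> A \subset 'Alt_T.
Proof.
move=> <-; rewrite gen_subG; apply/subsetP=> _ /imset2P[x y _ _ ->].
by rewrite Alt_even commgEl odd_permM odd_permJ odd_permV addbb.
Qed.

Section Normal60.

Variables (gT : finGroupType) (G P : {group gT}).
Hypotheses (nsPG : P <| G) (simP : simple P) (nabP : ~~ abelian P) (oP : #|P| = 60).

(** G permutes the five Sylow 2-subgroups of P. The kernel meets P trivially, both are normal, so
    they commute; the image of P is perfect of order 60, hence all of Alt_5. *)
Lemma normal60_morphism : exists f : {morphism G >-> {perm 'I_5}},
  'ker f = 'C_G(P) /\ f @* P = 'Alt_('I_5).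
Proof.
have [sPG nPG] := andP nsPG.
have actsG : [acts G, on 'Syl_2(P) | 'JG].
  apply/subsetP=> g Gg; rewrite !inE; apply/subsetP=> S; rewrite !inE /= => sylS.
  by rewrite -(normsP nPG g Gg) pHallJ2.
have [f kerf] := acts_perm_ord (card_Syl2_60 simP nabP oP) actsG; exists f.
have sCK : 'C_G(P) \subset 'ker f.
  rewrite kerf setIS //; apply/subsetP=> c cPc; apply/astabP=> S; rewrite inE => /pHall_sub sSP.
  apply/group_inj; rewrite /= (normP (subsetP (cent_sub _) c _)) //.
  by rewrite (subsetP (centS sSP)).
have TI : P :&: 'ker f = 1%g.
  have nsI : P :&: 'ker f <| P by rewrite (normalGI sPG) ?ker_normal.
  have [_ /(_ _ nsI)[//|/setIidPl sPK]] := simpleP _ simP.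
  have [S sylS] := Sylow_exists 2 P; have := card_Syl sylS.
  rewrite card_Syl2_60 // => n5; suff: #|P : 'N_P(S)| = 1 by rewrite -n5.
  apply/eqP; rewrite indexg_eq1 subsetI subxx /=; apply/subsetP=> g Pg.
  have sPC : P \subset 'ker f by []. rewrite kerf in sPC.
  have := subsetP sPC g Pg => /setIP[_ /astabP/(_ S)]; rewrite inE => /(_ sylS).
  by move/(congr1 (@gval gT)) => /= defS; apply/normP.
have defK : 'ker f = 'C_G(P).
  apply/eqP; rewrite eqEsubset sCK andbT subsetI subsetIl /=.
  apply/commG1P/trivgP; rewrite -TI subsetI.
  rewrite commg_subr (subset_trans (subsetIl _ _) nPG) /=.
  by rewrite commg_subl (subset_trans sPG) ?ker_norm.
have oA : #|f @* P| = 60.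
  by rewrite card_morphim (setIidPr sPG) /= -indexgI TI indexg1.
have perfA : (f @* P)^`(1)%g = f @* P by rewrite -morphim_der // simple_perfect.
split=> //; apply/eqP; rewrite eqEcard (perfect_sub_Alt perfA) card_Alt5 oA leqnn //.
Qed.

End Normal60.

Lemma isog_Alt5 (gT : finGroupType) (P : {group gT}) :
  simple P -> ~~ abelian P -> #|P| = 60 -> P \isog 'Alt_('I_5).
Proof.
move=> simP nabP oP; have [f [kerf <-]] := normal60_morphism (normal_refl P) simP nabP oP.
apply/isogP; exists f => //; rewrite kerf; have := simple_center1 simP nabP.
by rewrite /center => ->.
Qed.

(** * Perfect groups of large degree sum *)

Local Open Scope ring_scope.
Local Open Scope nat_scope.

Lemma sum_irr_norm (gT : finGroupType) (G : {group gT}) (i : Iirr G) :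
  (\sum_(x in G) 'chi_i x * ('chi_i x)^* = #|G|%:R)%R.
Proof. by rewrite -[RHS]mulr1 -[X in (_ = _ * X)%R](cfnorm_irr i) cfdotE mulVKf ?neq0CG. Qed.

Section BlockCount.

Variables (gT : finGroupType) (P M : {group gT}).
Hypothesis cMP : M \subset 'Z(P).
Local Notation block := (@central_block gT P M).

Let abM : abelian M.
Proof. by rewrite abelianE (subset_trans (central_sub cMP)) // centsC (subset_trans cMP) ?subsetIr. Qed.

Let linM (j : Iirr M) : 'chi_j \is a linear_char.
Proof. exact: (char_abelianP M abM). Qed.

Definition block_norm (j : Iirr M) g : algC := (\sum_(i in block j) 'chi_i g * ('chi_i g)^*)%R.

(* Orthogonality in M isolates the block over j; the inner sum is then given by
   second orthogonality in P, and is largest when j is principal. *)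
Lemma block_normE j g : g \in P ->
  (#|M|%:R * block_norm j g =
   \sum_(z in M) ('chi_j z)^* * \sum_i 'chi[P]_i (g * z)%g * ('chi_i g)^*)%R.
Proof.
move=> Pg.
have sum_z (z : gT) : z \in M -> (\sum_i 'chi[P]_i (g * z)%g * ('chi_i g)^* =
    \sum_(j' : Iirr M) 'chi_j' z * block_norm j' g)%R.
  move=> Mz; transitivity (\sum_(j' : Iirr M) \sum_(i in block j') 'chi[P]_i (g * z)%g * ('chi_i g)^*)%R.
    rewrite (exchange_big_dep xpredT) //=; apply: eq_bigr => i _.
    have [j' Bij] := central_block_ex cMP i.
    rewrite (big_pred1 j') // => j''; apply/idP/eqP => [Bij'|->//].
    exact: central_block_uniq Bij' Bij.
  apply: eq_bigr => j' _; rewrite mulr_sumr; apply: eq_bigr => i Bi.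
  by rewrite (central_blockM cMP Bi Pg Mz) mulrAC mulrC.
transitivity (\sum_(j' : Iirr M) (\sum_(z in M) 'chi_j' z * ('chi_j z)^*) * block_norm j' g)%R.
  rewrite (bigD1 j) //= [X in (_ + X)%R]big1 => [|j' nejj'].
    by rewrite addr0 sum_irr_norm.
  have := cfdot_irr j' j; rewrite (negPf nejj') cfdotE => /eqP.
  by rewrite mulf_eq0 invr_eq0 (negPf (neq0CG M)) => /eqP->; rewrite mul0r.
rewrite (eq_bigr _ (fun j' _ => mulr_suml _ _ _ _)) exchange_big /=.
apply: eq_bigr => z Mz; rewrite (sum_z z Mz) mulr_sumr; apply: eq_bigr => j' _.
by rewrite mulrA [('chi_j' z * _)%R]mulrC.
Qed.

Lemma block_norm_le j g : g \in P -> (block_norm j g <= block_norm 0 g)%R.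
Proof.
move=> Pg; have M0 : (0 < #|M|%:R :> algC)%R by rewrite ltr0n.
have ge0 : (0 <= block_norm j g)%R by apply: sumr_ge0 => i _; apply: mul_conjC_ge0.
rewrite -(ler_pM2l M0) -[leLHS]ger0_norm ?mulr_ge0 ?ler0n // !block_normE //.
apply: le_trans (ler_norm_sum _ _ _) _; apply: ler_sum => z Mz.
rewrite second_orthogonality_relation // normrM norm_conjC normC_lin_char //.
by rewrite irr0 cfun1E Mz rmorph1 ger0_norm // mulrb; case: ifP => _; rewrite ?ler0n.
Qed.

(** Summing [block_norm] over P counts each character of the block |P| times. *)
Lemma card_block_le j : #|block j| <= #|block 0%R|.
Proof.
have cardE j' : ((#|P| * #|block j'|)%:R = \sum_(g in P) block_norm j' g)%R.
  rewrite exchange_big /= (eq_bigr (fun=> #|P|%:R%R)) => [|i _]; last by rewrite sum_irr_norm.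
  by rewrite sumr_const natrM mulr_natr.
rewrite -(leq_pmul2l (cardG_gt0 P)) -(ler_nat algC) !cardE.
by apply: ler_sum => g Pg; apply: block_norm_le.
Qed.

End BlockCount.

Section TrivialCentre.

Variables (gT : finGroupType) (P M : {group gT}).
Hypotheses (perfP : P^`(1)%g = P) (maxM : maxnormal M P P).
Hypothesis bigP : #|P| < 4 * \sum_i ideg (i : Iirr P).

Let cMP : M \subset 'Z(P) := maxnormal_central perfP maxM (classes_large bigP).
Local Notation block := (@central_block gT P M).

Let oPM : #|P : M| = 60.
Proof. by rewrite -card_quotient ?normal_norm ?central_normal // (maxnormal_index60 perfP maxM). Qed.

Lemma block0_degrees : #|block 0%R| = 5 /\ \sum_(i in block 0%R) ideg i = 16.
Proof.
have simL := maxnormal_quo_simple maxM; have nabL := maxnormal_quo_nabelian perfP maxM.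
have [k5 d16] := degrees60 simL nabL (maxnormal_index60 perfP maxM bigP).
have nsMP := central_normal cMP.
have reidx (F : Iirr P -> nat) : \sum_(i in block 0%R) F i = \sum_(k : Iirr (P / M)) F (mod_Iirr k).
  rewrite (eq_bigl (fun i => M \subset cfker 'chi_i)) => [|i]; last exact: (block0P perfP maxM bigP).
  rewrite (reindex _ (mod_Iirr_bij nsMP)) /=; apply: eq_bigl => k.
  by rewrite mod_IirrE // cfker_mod.
split.
  by rewrite -sum1_card reidx sum1_card card_ord NirrE.
rewrite reidx -d16; apply: eq_bigr => k _; apply/eqP; rewrite -(eqr_nat algC) -!irr1E.
by rewrite mod_IirrE // cfMod1.
Qed.

(** Some chi_j(z) has order c > 1. By the determinant c divides all degrees of the block, so c^2
    divides their sum of squares 60, and c = 2. *)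
Lemma block_degree_even (j : Iirr M) i : j != 0%R -> i \in block j -> 2 %| ideg i.
Proof.
move=> nz_j Bi.
have linj := central_lin_char perfP maxM bigP j.
have [z Mz lz] : exists2 z, z \in M & ('chi_j z != 1)%R.
  apply/exists_inP; apply: contraR nz_j => /exists_inPn all1; rewrite -irr_eq1.
  by apply/eqP/cfun_inP=> z Mz; rewrite cfun1E Mz; apply/eqP/negPn; apply: all1.
have zX : ('chi_j z ^+ #[z] = 1)%R by rewrite -lin_charX // expg_order lin_char1.
have [c prim_c _] := prim_order_exists (order_gt0 z) zX.
have dvd_c k : k \in block j -> c %| ideg k.
  by move=> Bk; rewrite (prim_order_dvd prim_c) (central_block_det cMP perfP Bk Mz).
suff <- : c = 2 by apply: dvd_c.
have c1 : c != 1 by apply: contraNneq lz => c1; have := prim_expr_order prim_c; rewrite c1 expr1 => ->.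
have : c ^ 2 %| 60.
  rewrite -oPM -(block_sum_sqr perfP maxM bigP j); apply: dvdn_sum => k Bk.
  by rewrite dvdn_exp2r ?dvd_c.
have c0 := prim_order_gt0 prim_c; move=> c60.
have lt8 : c < 8 by rewrite -(ltn_exp2r _ _ (isT : 0 < 2)) (leq_ltn_trans (dvdn_leq _ c60)).
by move: c c0 c1 c60 lt8 {prim_c dvd_c}; do 8?case=> //.
Qed.

(** At most five degrees from 2, 4, 6 with squares summing to 60: only 2, 2, 4, 6. *)
Lemma block_degree_sum (j : Iirr M) : j != 0%R -> \sum_(i in block j) ideg i <= 14.
Proof.
move=> nz_j; have sqr := block_sum_sqr perfP maxM bigP j; rewrite oPM in sqr.
have [card0 _] := block0_degrees; have := card_block_le cMP j; rewrite card0 -sum1_card.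
have deg i : i \in block j -> ideg i \in [:: 2; 4; 6].
  move=> Bi; have d_even := block_degree_even nz_j Bi; have d_gt0 := ideg_gt0 i.
  have : ideg i ^ 2 <= 60 by rewrite -sqr (bigD1 i) //= leq_addr.
  have lt8 : ideg i ^ 2 <= 60 -> ideg i < 8.
    by move=> le60; rewrite -(ltn_exp2r _ _ (isT : 0 < 2)) (leq_ltn_trans le60).
  by move/lt8; move: (ideg i) d_even d_gt0; do 8?case=> //.
have split3 F : \sum_(i in block j) F (ideg i) =
   F 2 * \sum_(i in block j | ideg i == 2) 1 + F 4 * \sum_(i in block j | ideg i == 4) 1 +
   F 6 * \sum_(i in block j | ideg i == 6) 1.
  rewrite !big_distrr /= [X in X + _ + _]big_mkcondr [X in _ + X + _]big_mkcondr.
  rewrite [X in _ + X]big_mkcondr -!big_split /=; apply: eq_bigr => i /deg.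
  by rewrite !inE => /or3P[]/eqP->; rewrite /= ?addn0 ?add0n muln1.
rewrite (split3 (fun=> 1)) (split3 id); move: sqr; rewrite (split3 (fun d => d ^ 2)).
move: (\sum_(i in block j | ideg i == 2) 1) (\sum_(i in block j | ideg i == 4) 1) (\sum_(i in block j | ideg i == 6) 1).
by clear; move=> a b c; lia.
Qed.

(** For m = |M|, the bounds 15 m < T(P) <= 16 + 14 (m - 1) force m = 1. *)
Lemma maxnormal_trivial : M :=: 1%g.
Proof.
have [_ T0] := block0_degrees.
have : \sum_i ideg (i : Iirr P) <= 16 + 14 * (#|M| - 1).
  rewrite (sum_central_blocks perfP maxM bigP) (bigD1 (0%R : Iirr M)) //= T0 leq_add2l.
  have -> : 14 * (#|M| - 1) = \sum_(j : Iirr M | j != 0%R) 14.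
    have abM : abelian M.
      by rewrite abelianE (subset_trans (central_sub cMP)) // centsC (subset_trans cMP) ?subsetIr.
    have -> : #|M| = \sum_(j : Iirr M) 1 by rewrite sum1_card card_Iirr_abelian.
    by rewrite (bigD1 (0%R : Iirr M)) //= addKn big_distrr /=; apply: eq_bigr.
  by apply: leq_sum => j; apply: block_degree_sum.
have := bigP; rewrite -(Lagrange (central_sub cMP)) oPM.
have := cardG_gt0 M => M0 lt le; apply/eqP; rewrite trivg_card1.
apply/eqP; move: M0 lt le; move: #|M| (\sum_i _) => m T; clear; lia.
Qed.

Lemma perfect_large_sum60 : simple P /\ #|P| = 60.
Proof.
have M1 := maxnormal_trivial; have := maxnormal_quo_simple maxM.
rewrite quotient_simple ?(central_normal cMP) // => maxM1.
split; first by rewrite simple_maxnormal -M1.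
by rewrite -(Lagrange (central_sub cMP)) M1 cards1 mul1n -oPM M1.
Qed.

End TrivialCentre.

(** * Nonsolvable groups *)

(** A minimal nonsolvable normal subgroup equals its derived subgroup, which is again normal and
    nonsolvable. *)
Lemma nsol_perfect_normal (gT : finGroupType) (G : {group gT}) :
  ~~ solvable G -> exists P : {group gT}, [/\ P <| G, P^`(1)%g = P & P :!=: 1%g].
Proof.
move=> nsolG; pose nsol (H : {set gT}) := (H <| G) && ~~ solvable H.
have [|P /mingroupP[/andP[nsPG nsolP] minP] _] := @mingroup_exists _ nsol G.
  by rewrite /nsol normal_refl.
exists P; split=> //; last by apply: contraNneq nsolP => ->; apply: solvable1.
apply: minP (der_sub 1 P); rewrite /nsol gFnormal_trans //=.
apply: contra nsolP => sol'; rewrite (series_sol (der_normal 1 P)) sol' /=.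
exact/abelian_sol/sub_der1_abelian.
Qed.

(** At most |G|/2 characters are linear and the others have degree at least 2, so 4 k(G) <= |G| + 3
    |G|/2. *)
Lemma nonabelian_classes_le (gT : finGroupType) (G : {group gT}) :
  ~~ abelian G -> 8 * #|classes G| <= 5 * #|G|.
Proof.
move=> nabG; pose n1 := #|G : G^`(1)%g|; pose lin := [pred i : Iirr G | 'chi_i \is a linear_char].
have linE i : (i \in lin) = (ideg i == 1) by rewrite !inE qualifE /= irr_char irr1E pnatr_eq1.
have n1E : n1 = \sum_(i in lin) 1 by rewrite /n1 -card_lin_irr sum1_card.
have le1 : 2 * n1 <= #|G|.
  rewrite -(Lagrange (der_sub 1 G)) leq_mul2r; apply/orP; right.
  by rewrite cardG_gt1; apply: contra nabG => /eqP/derG1P.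
suffices: 4 * #|classes G| <= #|G| + 3 * n1 by lia.
have -> : 4 * #|classes G| = \sum_(i : Iirr G) 4 by rewrite sum_nat_const card_ord NirrE mulnC.
rewrite n1E big_distrr /= [X in _ + X]big_mkcond -sum_ideg_sqr -big_split /=.
apply: leq_sum => i _; have := ideg_gt0 i; rewrite linE; case: eqP => [->|] //.
by move: (ideg i); clear; move=> d d1 d0; nia.
Qed.

(** * A 5-cycle and its square in Sym_5 and Alt_5 *)

Section Symmetric5.

Local Notation o n := (inord n : 'I_5).
(* x |-> x + 1 and x |-> 2 x on Z/5, the latter odd and squaring the former
   by conjugation. *)
Definition cycle5 : {perm 'I_5} := (tperm (o 0) (o 1) * tperm (o 0) (o 2) * tperm (o 0) (o 3) * tperm (o 0) (o 4))%g.
Definition double5 : {perm 'I_5} := (tperm (o 1) (o 2) * tperm (o 1) (o 4) * tperm (o 1) (o 3))%g.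

Local Notation c := cycle5.
Local Notation g := double5.

Let oE n m : n < 5 -> m < 5 -> (o n == o m) = (n == m).
Proof. by move=> ln lm; rewrite -val_eqE /= !inordK. Qed.

Let cE (x : 'I_5) : c x = o (x.+1 %% 5).
Proof.
rewrite -[x]inord_val /cycle5 !permM; case: x => [[|[|[|[|[|x]]]]] lx] //=;
by rewrite !permE /= !oE //= ?oE //= ?oE //= ?oE //= inordK.
Qed.
Let gE (x : 'I_5) : g x = o (2 * x %% 5).
Proof.
rewrite -[x]inord_val /double5 !permM; case: x => [[|[|[|[|[|x]]]]] lx] //=;
by rewrite !permE /= !oE //= ?oE //= ?oE //= ?oE //= inordK.
Qed.

Let cX (n : nat) : (c ^+ n)%g (o 0) = o (n %% 5).
Proof.
elim: n => [|n IHn]; first by rewrite expg0 perm1.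
by rewrite expgSr permM IHn cE inordK ?ltn_mod //; congr inord; rewrite -addn1 modnDml addn1.
Qed.

(** If an even h also squared c by conjugation, the odd permutation g h^-1 would centralise c; but
    the centraliser of a 5-cycle consists of its powers, which are even. *)
Lemma Sym5_fusion : exists c g : {perm 'I_5},
  [/\ c \in 'Alt_('I_5), (c ^ g = c * c)%g & forall h, h \in 'Alt_('I_5) -> (c ^ h != c * c)%g].
Proof.
have Ac : c \in 'Alt_('I_5) by rewrite Alt_even /cycle5 !odd_permM !odd_tperm !oE.
have cg : (c ^ g = c * c)%g.
  apply: (mulgI g); rewrite conjgE mulKVg.
  apply/permP=> x; rewrite (permM c) (permM g) (permM c) !(cE, gE) !inordK ?ltn_mod //; congr inord.
  by case: x => [[|[|[|[|[|x]]]]] lx].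
exists c, g; split=> // h Ah; apply/eqP=> ch.
pose s := (g * h^-1)%g; have cs : (c ^ s = c)%g by rewrite conjgM cg -ch conjgK.
have Xs n x : s ((c ^+ n)%g x) = (c ^+ n)%g (s x).
  have /commute_sym sc : commute c s by apply/commgP/conjg_fixP.
  by rewrite -!permM -(commuteX n sc).
suff: s \in 'Alt_('I_5).
  by rewrite groupMr ?groupV // Alt_even /double5 !odd_permM !odd_tperm !oE.
(* As c is transitive, a permutation commuting with it is determined by the image of 0. *)
have -> : s = (c ^+ s (o 0))%g; last exact: groupX.
have orb x : x = (c ^+ (x : 'I_5))%g (o 0) by rewrite cX modn_small ?inord_val.
apply/permP=> x; rewrite {1}(orb x) Xs {1}(orb (s (o 0))) -!permM -!expgD addnC.
by rewrite expgD permM -orb.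
Qed.

End Symmetric5.

Section NormalSimple60.

Variables (gT : finGroupType) (G P : {group gT}).
Hypotheses (nsPG : P <| G) (simP : simple P) (nabP : ~~ abelian P) (oP : #|P| = 60).
Variable f : {morphism G >-> {perm 'I_5}}.
Hypotheses (kerf : 'ker f = 'C_G(P)) (fP : f @* P = 'Alt_('I_5)).

Let sPG : P \subset G. Proof. exact: normal_sub. Qed.

Let tiPC : P :&: 'C_G(P) = 1%g.
Proof.
apply/trivgP; rewrite -(simple_center1 simP nabP) /center setIS //.
exact: subsetIr.
Qed.

Let f_inj : {in P &, injective f}.
Proof.
move=> x y Px Py fxy; apply/eqP; rewrite eq_mulgV1 -in_set1 -[[set 1%g]]tiPC -kerf.
rewrite inE groupM ?groupV //=; have [Gx Gy] := (subsetP sPG x Px, subsetP sPG y Py).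
by apply/kerP; rewrite ?groupM ?groupV // morphM ?groupV // morphV // fxy mulgV.
Qed.

Lemma odd_action_sum_le :
  ~~ (f @* G \subset 'Alt_('I_5)) -> \sum_i ideg (i : Iirr G) <= #|G : P| * 13.
Proof.
case/subsetPn=> h fGh odd_h; have [c [g [Ac cg ncg]]] := Sym5_fusion.
have fGA : 'Alt_('I_5) \subset f @* G by rewrite -fP morphimS.
have odd_g : g \notin 'Alt_('I_5) by apply: contraL (eqxx (c * c)%g) => /ncg; rewrite cg.
have fGg : g \in f @* G.
  rewrite -(mulgKV h g) groupM // (subsetP fGA) // Alt_even odd_permM odd_permV.
  by move: odd_g odd_h; rewrite !Alt_even !negbK => -> ->.
have /morphimP[g0 _ Gg0 gE] := fGg.
have /morphimP[c0 Gc0 Pc0 cE] : c \in f @* P by rewrite fP.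
have c0g : (c0 ^ g0 = c0 * c0)%g.
  apply: f_inj; [by rewrite memJ_norm ?(subsetP (normal_norm nsPG)) | exact: groupM |].
  by rewrite morphJ // morphM // -gE -cE cg.
(* If all characters agreed, c and c^2 would be conjugate in P, that is by an even permutation. *)
have [t neq_t] : exists t : Iirr P, ('chi_t c0 != 'chi_t (c0 * c0)%g)%R.
  apply/existsP; apply: contraT; rewrite negb_exists => /forallP-all_eq.
  have /imsetP[k Pk ck] : c0 \in (c0 * c0)%g ^: P.
    by apply/eq_irr_mem_classP=> [|i]; [rewrite groupM | apply/eqP/negPn/all_eq].
  have Gk := subsetP sPG k Pk.
  have: f k^-1%g \in 'Alt_('I_5) by rewrite -fP mem_morphim ?groupV.
  have c0k : (c0 ^ k^-1 = c0 * c0)%g by rewrite [X in (X ^ _)%g]ck conjgK.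
  by move/ncg/eqP; case; rewrite cE -morphJ ?groupV // c0k morphM.
have nz_t : t != 0%R.
  by apply: contraNneq neq_t => ->; rewrite irr0 !cfun1E Pc0 groupM.
pose t' := conjg_Iirr t g0.
have nPg0 := subsetP (normal_norm nsPG) g0 Gg0.
have t't : t' != t.
  apply: contraNneq neq_t => t't; rewrite -c0g -[X in (_ == 'chi_X _)%R]t't.
  by rewrite conjg_IirrE cfConjgEJ.
have sum13 : \sum_(j in [set~ t]) ideg j <= 13.
  have [_ T16] := degrees60 simP nabP oP; have := simple_ideg_ge3 simP nabP nz_t.
  have -> : \sum_(j in [set~ t]) ideg j = \sum_(j | j != t) ideg j.
    by apply: eq_bigl => j; rewrite in_setC1.
  rewrite (bigD1 t) //= in T16; move=> ge3.
  by rewrite -(leq_add2l (ideg t)) T16 (leq_add2r 13 3).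
apply: leq_trans (sum_ideg_sub sPG _) (leq_mul (leqnn _) sum13) => i.
have [j] := constt_cfRes_irr P i; have [-> tRi|nt Rj] := eqVneq j t.
  exists t'; first by rewrite in_setC1.
  rewrite irr_consttE conjg_IirrE -(cfConjg_id 'chi_i Gg0) -(cfConjgRes _ (normal_refl G)) //.
  by rewrite cfConjg_iso -irr_consttE.
by exists j; rewrite ?in_setC1.
Qed.

Lemma even_action_dprod :
  f @* G \subset 'Alt_('I_5) -> P \x 'C_G(P) = G.
Proof.
move=> sfA; have fG : f @* G = f @* P.
  by apply/eqP; rewrite eqEsubset fP sfA -fP morphimS.
rewrite dprodE ?subsetIr //; apply/eqP; rewrite eqEsubset mul_subG ?subsetIl //=.
have /centC-> : P \subset 'C('C_G(P)) by rewrite centsC subsetIr.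
by rewrite -kerf -morphimSK // fG.
Qed.

(** Here k(G) = 5 k(C) for C = C_G(P); a nonabelian C has k(C) <= 5|C|/8, so 16 k(G) <= 50 |C| < 60
    |C| = |G|. *)
Lemma even_action_cent_abelian :
  P \x 'C_G(P) = G -> #|G| < 16 * #|classes G| -> abelian 'C_G(P).
Proof.
move=> defG; apply: contraTT => nabC.
have oG := dprod_card defG; have [kP _] := degrees60 simP nabP oP.
have kG : #|classes G| = 5 * #|classes 'C_G(P)|.
  have := bij_eq_card (Bijective (dprod_IirrK defG) (inv_dprod_IirrK defG)).
  by rewrite card_prod !card_ord !NirrE kP.
have := nonabelian_classes_le nabC; rewrite kG -oG oP -leqNgt; move: #|classes _| #|'C_G(P)|; clear=> k n; lia.
Qed.

End NormalSimple60.

Lemma nonsolvable_Alt5 (gT : finGroupType) (G : {group gT}) :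
  #|G| < 4 * \sum_i ideg (i : Iirr G) -> ~~ solvable G ->
  exists (zT : finGroupType) (Z : {group zT}),
    abelian Z /\ G \isog setX 'Alt_('I_5) Z.
Proof.
move=> bigG nsolG; have [P [nsPG perfP ntP]] := nsol_perfect_normal nsolG.
have bigP := large_sum_sub (normal_sub nsPG) bigG.
have [M maxM] := ex_maxnormal_ntrivg ntP.
have [simP oP] := perfect_large_sum60 perfP maxM bigP.
have nabP : ~~ abelian P by apply: contra ntP => /derG1P P'1; rewrite -perfP P'1.
have [f [kerf fP]] := normal60_morphism nsPG simP nabP oP.
have sfA : f @* G \subset 'Alt_('I_5).
  apply: contraLR bigG => /(odd_action_sum_le nsPG simP nabP oP kerf fP).
  rewrite -(Lagrange (normal_sub nsPG)) oP -leqNgt; move: #|G : P| (\sum_i _); clear=> n T; lia.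
have defG := even_action_dprod nsPG simP nabP kerf fP sfA.
exists gT, 'C_G(P)%G; split.
  exact: (even_action_cent_abelian simP nabP oP defG (classes_large bigG)).
have defX := setX_dprod 'Alt_('I_5)%G 'C_G(P)%G.
apply: isog_dprod defG defX _ (isog_set1X _ _).
exact: isog_trans (isog_Alt5 simP nabP oP) (isog_setX1 _ _).
Qed.

Lemma solvable_fitting_height (gT : finGroupType) (G : {group gT}) :
  #|G| < 4 * \sum_i ideg (i : Iirr G) -> solvable G -> fitting_height G <= 4.
Proof.
move=> bigG solG; rewrite fitting_height_le //; apply/eqP/(@fitting_series_full #|G|).
apply: contraTeq (classes_large bigG) => res4.
have := nil_residual4_commuting (leqnn _) solG res4.
by rewrite commuting_pairsE mulnA expnS expn1 leq_pmul2r // -leqNgt.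
Qed.

Theorem theorem2 (gT : finGroupType) (G : {group gT}) :
  ((4%:R)^-1 * #|G|%:R < char_degree_sum G)%R ->
  (solvable G /\ fitting_height G <= 4) \/
  (exists (zT : finGroupType) (Z : {group zT}),
     abelian Z /\ G \isog setX 'Alt_('I_5) Z).
Proof.
rewrite char_degree_sum_gt => bigG; case: (boolP (solvable G)) => [solG | nsolG].
  by left; split=> //; apply: solvable_fitting_height.
by right; apply: nonsolvable_Alt5.
Qed.
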